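(* For any domain $\Omega$ in $\mathbb R^d$ of finite measure and $k,t,s,m\in\mathbb N$ such that $t\le s\le m$, the following inequalities hold: (i) $\left[\lambda_k^{(m,t)}(\Omega)\right]^{1/t}\le\left[\lambda_k^{(m+1,t+1)}(\Omega)\right]^{1/(t+1)}$; (ii) $\lambda_k^{(m,t)}(\Omega)\le\lambda_k^{(m+1,t)}(\Omega)$; (iii) $\left[\lambda_k^{(m,s)}(\Omega)\right]^{1/s}\le\left[\lambda_k^{(m,t)}(\Omega)\right]^{1/t}$.
   Context: A domain is a connected open set; $d\ge1$; $\mathbb N$ is the set of positive integers. For an integer $p\ge 0$ set $\nabla^p u=\Delta^j u$ if $p=2j$ and $\nabla^p u=\nabla\Delta^j u$ if $p=2j+1$. For a domain $\Omega\subset\mathbb R^d$ of finite Lebesgue measure and integers $1\le t\le m$, $0<\lambda_1^{(m,t)}(\Omega)\le\lambda_2^{(m,t)}(\Omega)\le\cdots$ denote the eigenvalues (repeated according to multiplicity) of the problem $(-\Delta)^m u=\lambda(-\Delta)^{m-t}u$ in $\Omega$, $u=\frac{\partial u}{\partial\nu}=\dots=\frac{\partial^{m-1}u}{\partial\nu^{m-1}}=0$ on $\partial\Omega$, understood in the weak sense: $u\in H^m_0(\Omega)$ and $\int_\Omega\nabla^m u\cdot\nabla^m\phi=\lambda\int_\Omega\nabla^{m-t}u\cdot\nabla^{m-t}\phi$ for all $\phi\in H^m_0(\Omega)$. Equivalently, $$\lambda_k^{(m,t)}(\Omega)=\min_{V\subset H^m_0(\Omega),\,\dim V=k}\ \max_{0\ne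 u\in V}\frac{\int_\Omega|\nabla^m u|^2}{\int_\Omega|\nabla^{m-t}u|^2}.$$ *)

(* Defs.v *)
From HB Require Import structures.
From mathcomp Require Import all_boot all_order all_algebra.
From mathcomp Require Import all_classical all_reals all_analysis.
Set Implicit Arguments.
Unset Strict Implicit.
Unset Printing Implicit Defensive.
Import Order.TTheory GRing.Theory Num.Theory.
Import numFieldNormedType.Exports.
Local Open Scope classical_set_scope.
Local Open Scope ring_scope.

Definition rV_display : measure_display.
Proof. by constructor. Qed.

(* The sigma-algebra generated by the coordinates, i.e. the Borel one. *)
Section measurable_rV.
Context {R : realType} (n : nat).
Let coord (i : 'I_n) (x : 'rV[R]_n) : measurableTypeR R := x ord0 i.
Let rV_set0 : g_sigma_preimage coord set0.
Proof. exact: sigma_algebra0. Qed.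
Let rV_setC A : g_sigma_preimage coord A -> g_sigma_preimage coord (~` A).
Proof. exact: sigma_algebraC. Qed.
Let rV_bigcup (F : (set 'rV[R]_n)^nat) :
  (forall i, g_sigma_preimage coord (F i)) ->
  g_sigma_preimage coord (\bigcup_i F i).
Proof. exact: sigma_algebra_bigcup. Qed.
HB.instance Definition _ := @isMeasurable.Build rV_display 'rV[R]_n
  (g_sigma_preimage coord) rV_set0 rV_setC rV_bigcup.
End measurable_rV.

Section lebesgue_rV.
Local Open Scope ereal_scope.
Context {R : realType}.

Definition cons_rV n (p : measurableTypeR R * 'rV[R]_n) : 'rV[R]_n.+1 :=
  row_mx (p.1)%:M p.2 : 'rV_(1 + n).

Definition uncons_rV n (x : 'rV[R]_n.+1) : measurableTypeR R * 'rV[R]_n :=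
  (x ord0 ord0, \row_j x ord0 (lift ord0 j)).

Lemma cons_rV0 n p : @cons_rV n p ord0 ord0 = p.1.
Proof.
by rewrite /cons_rV mxE; case: splitP => // j; rewrite ord1 mxE eqxx mulr1n.
Qed.

Lemma cons_rVS n p j : @cons_rV n p ord0 (lift ord0 j) = p.2 ord0 j.
Proof.
rewrite /cons_rV mxE; case: splitP => k /=; rewrite /bump/=.
  by rewrite ord1.
by move=> /addnI jk; congr (p.2 _ _); exact/val_inj.
Qed.

Lemma cons_rVK n : cancel (@cons_rV n) (@uncons_rV n).
Proof.
move=> [a v]; rewrite /uncons_rV cons_rV0; congr (_, _).
by apply/rowP => j; rewrite mxE cons_rVS.
Qed.

Lemma measurable_coord_rV n (i : 'I_n) :
  measurable_fun [set: 'rV[R]_n] (fun x => x ord0 i : measurableTypeR R).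
Proof.
move=> _ Y mY; rewrite setTI; apply: sub_sigma_algebra.
rewrite -bigcup_seq/=; exists i => /=; first by rewrite mem_index_enum.
by exists Y => //; rewrite setTI.
Qed.

Lemma measurable_fun_rVP d (T : measurableType d) n (f : T -> 'rV[R]_n) :
  (forall i, measurable_fun [set: T] (fun x => f x ord0 i : measurableTypeR R)) ->
  measurable_fun [set: T] f.
Proof.
pose coord i (x : 'rV[R]_n) : measurableTypeR R := x ord0 i.
move=> mf _ A mA.
have : g_sigma_preimage (fun i => coord i \o f) `<=` measurable.
  apply: smallest_sub; first exact: sigma_algebra_measurable.
  rewrite -bigcup_seq; apply: bigcup_sub => i _ B [C mC <-].
  exact: mf.
rewrite (@g_sigma_preimage_comp _ (measurableTypeR R) n _ coord _ f).
by move=> sub; apply: sub; exists A.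
Qed.

Lemma measurable_cons_rV n : measurable_fun [set: _] (@cons_rV n).
Proof.
apply: measurable_fun_rVP => i; have [j ->|->] := unliftP ord0 i.
  rewrite [X in measurable_fun _ X](_ : _ =
      (fun x : 'rV[R]_n => x ord0 j : measurableTypeR R) \o snd).
    by apply: measurableT_comp => //; exact: measurable_coord_rV.
  by apply/funext => x /=; rewrite cons_rVS.
rewrite [X in measurable_fun _ X](_ : _ = fst); first exact: measurable_fst.
by apply/funext => x; rewrite cons_rV0.
Qed.

Lemma measurable_uncons_rV n : measurable_fun [set: _] (@uncons_rV n).
Proof.
apply: measurable_fun_pair; first exact: measurable_coord_rV.
apply: measurable_fun_rVP => i.
rewrite [X in measurable_fun _ X](_ : _ =
    fun x : 'rV[R]_n.+1 => x ord0 (lift ord0 i)).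
  exact: measurable_coord_rV.
by apply/funext => x; rewrite mxE.
Qed.

Section step.
Variables (n : nat) (mu : {sigma_finite_measure set 'rV[R]_n -> \bar R}).

Definition lebesgue_rV_step : set 'rV[R]_n.+1 -> \bar R :=
  pushforward (lebesgue_measure \x mu) (@cons_rV n).

Let step0 : lebesgue_rV_step set0 = 0.
Proof. by rewrite /lebesgue_rV_step /pushforward preimage_set0 measure0. Qed.

Let step_ge0 A : 0 <= lebesgue_rV_step A.
Proof. by rewrite /lebesgue_rV_step /pushforward measure_ge0. Qed.

Let step_sigma_additive : semi_sigma_additive lebesgue_rV_step.
Proof.
move=> F mF tF mUF; rewrite /lebesgue_rV_step /pushforward preimage_bigcup.
have mc := @measurable_cons_rV n.
apply: measure_semi_sigma_additive.
- by move=> i; rewrite -[X in measurable X]setTI; exact: mc.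
- apply/trivIsetP => /= i j _ _ ij; rewrite -preimage_setI.
  by move/trivIsetP : tF => /(_ _ _ _ _ ij) ->//; rewrite preimage_set0.
- by rewrite -preimage_bigcup -[X in measurable X]setTI; exact: mc.
Qed.

HB.instance Definition _ := isMeasure.Build _ _ _ lebesgue_rV_step
  step0 step_ge0 step_sigma_additive.

Let step_sigma_finite : sigma_finite setT lebesgue_rV_step.
Proof.
have /sigma_finiteP[F [TF ndF Foo]] := sigma_finiteT (@lebesgue_measure R).
have /sigma_finiteP[G [TG ndG Goo]] := sigma_finiteT mu.
have cE i : @cons_rV n @^-1` (@uncons_rV n @^-1` (F i `*` G i)) = F i `*` G i.
  rewrite -comp_preimage (_ : _ \o _ = id)//.
  by apply/funext => x /=; rewrite cons_rVK.
exists (fun i => @uncons_rV n @^-1` (F i `*` G i)) => [|i].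
  rewrite -preimage_bigcup -(preimage_setT (@uncons_rV n)); congr (_ @^-1` _).
  apply/seteqP; split => // -[x y] _.
  have [i _ Fi] : (\bigcup_i F i) x by rewrite -TF.
  have [j _ Gj] : (\bigcup_j G j) y by rewrite -TG.
  exists (maxn i j) => //; split.
    by move: x Fi; exact/subsetPset/ndF/leq_maxl.
  by move: y Gj; exact/subsetPset/ndG/leq_maxr.
have [mF Fi] := Foo i; have [mG Gi] := Goo i; split.
  rewrite -[X in measurable X]setTI; apply: measurable_uncons_rV => //.
  exact: measurableX.
rewrite /lebesgue_rV_step /pushforward cE product_measure1E//.
by rewrite lte_mul_pinfty// ge0_fin_numE.
Qed.

HB.instance Definition _ := @Measure_isSigmaFinite.Build _ _ _
  lebesgue_rV_step step_sigma_finite.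

End step.

(* Lebesgue measure on R^n as the n-fold product of the one on R; R^0 is a
   point. *)
Fixpoint lebesgue_rV n : {sigma_finite_measure set 'rV[R]_n -> \bar R} :=
  if n is n'.+1 then lebesgue_rV_step (lebesgue_rV n') else dirac (0%R : 'rV[R]_0).

End lebesgue_rV.

Section sobolev.
Context {R : realType} {d : nat}.
Implicit Types (Omega : set 'rV[R]_d) (u v phi : 'rV[R]_d -> R).
Local Notation mu := (@lebesgue_rV R d).

Definition domain Omega := open Omega /\ connected Omega.

(* A multi-index is the list of the directions of differentiation. *)
Definition partial (s : seq 'I_d) phi : 'rV[R]_d -> R :=
  foldr (fun i f => 'D_(delta_mx ord0 i) f) phi s.

Definition smooth phi := forall s : seq 'I_d,
  continuous (partial s phi) /\
  forall i x, derivable (partial s phi) x (delta_mx ord0 i).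

Definition test_function Omega phi := smooth phi /\
  exists K : set 'rV[R]_d,
    [/\ compact K, K `<=` Omega & forall x, ~ K x -> phi x = 0].

Definition L2 Omega u := measurable_fun Omega u /\
  (\int[mu]_(x in Omega) (u x ^+ 2)%:E < +oo)%E.

Definition is_weak_partial Omega (s : seq 'I_d) u v :=
  forall phi, test_function Omega phi ->
    \int[mu]_(x in Omega) (u x * partial s phi x) =
    (-1) ^+ size s * \int[mu]_(x in Omega) (v x * phi x).

(* Unique up to a null set whenever it exists. *)
Definition weak_partial Omega (s : seq 'I_d) u : 'rV[R]_d -> R :=
  xget (cst 0) [set v | L2 Omega v /\ is_weak_partial Omega s u v].

Definition sobolev Omega (m : nat) u := L2 Omega u /\
  forall s : seq 'I_d, (size s <= m)%N ->
    exists v, L2 Omega v /\ is_weak_partial Omega s u v.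

(* Each multi-index is counted once for each ordering of its directions, which
   gives a norm equivalent to the usual one. *)
Definition sobolev_sqnorm Omega (m : nat) u : \bar R :=
  (\sum_(j < m.+1) \sum_(s : j.-tuple 'I_d)
    \int[mu]_(x in Omega) (weak_partial Omega s u x ^+ 2)%:E)%E.

(* The closure of the test functions in H^m. *)
Definition sobolev0 Omega (m : nat) u := sobolev Omega m u /\
  forall e : R, 0 < e -> exists phi, test_function Omega phi /\
    (sobolev_sqnorm Omega m (u \- phi)%R < e%:E)%E.

Definition laplacian Omega u : 'rV[R]_d -> R :=
  fun x => \sum_(i < d) weak_partial Omega [:: i; i] u x.

(* |nabla^p u|^2, where nabla^(2j) = Delta^j and nabla^(2j+1) = nabla Delta^j *)
Definition sqr_nabla Omega (p : nat) u : 'rV[R]_d -> R :=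
  let v := iter p./2 (laplacian Omega) u in
  if odd p then fun x => \sum_(i < d) weak_partial Omega [:: i] v x ^+ 2
  else fun x => v x ^+ 2.

Definition rayleigh Omega (m t : nat) u : R :=
  (\int[mu]_(x in Omega) sqr_nabla Omega m u x) /
  (\int[mu]_(x in Omega) sqr_nabla Omega (m - t) u x).

Definition null_on Omega u := \forall x \ae mu, Omega x -> u x = 0.

Definition lincomb k (b : 'I_k -> 'rV[R]_d -> R) (c : 'I_k -> R) :
    'rV[R]_d -> R :=
  fun x => \sum_(i < k) c i * b i x.

(* A basis of a k-dimensional subspace of H^m_0, whose elements are functions
   modulo equality almost everywhere. *)
Definition sobolev0_basis Omega (m k : nat) (b : 'I_k -> 'rV[R]_d -> R) :=
  (forall i, sobolev0 Omega m (b i)) /\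
  forall c, null_on Omega (lincomb b c) -> forall i, c i = 0.

(* The min-max formula for the k-th eigenvalue, k >= 1, counted with
   multiplicity. The inner supremum and the outer infimum are attained when
   Omega is a nonempty domain of finite measure and 1 <= t <= m. The
   denominator of the Rayleigh quotient is then nonzero for u nonzero. *)
Definition kth_eigenvalue Omega (m t k : nat) : \bar R :=
  ereal_inf [set ereal_sup [set (rayleigh Omega m t u)%:E |
                            u in [set u | (exists c, u = lincomb b c) /\
                                          ~ null_on Omega u]] |
             b in [set b | @sobolev0_basis Omega m k b]].

End sobolev.

(* Main.v *)
Require Import Defs.
From mathcomp Require Import all_boot all_order all_algebra.
From mathcomp Require Import all_classical all_reals all_analysis.
From mathcomp Require Import measurable_realfun ring lra zify.
Local Open Scope ring_scope.
Set Implicit Arguments.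
Unset Strict Implicit.
Unset Printing Implicit Defensive.
Import Order.TTheory GRing.Theory Num.Theory.
Import numFieldNormedType.Exports.
Local Open Scope classical_set_scope.

(* Put E_p(u) for the integral of |nabla^p u|^2. For a test function,
   integration by parts gives E_(p+1)(u) = - <nabla^p u, nabla^(p+2) u>, so
   Cauchy-Schwarz yields E_(p+1)^2 <= E_p E_(p+2). This passes to u in H^m_0
   for p + 2 <= m by density: the ratios E_(p+1)/E_p are nondecreasing in p.
   Each inequality compares two Rayleigh quotients of the same u, both of which
   are products of consecutive ratios; the min-max formula and the inclusion of
   H^(m+1)_0 in H^m_0 transfer the comparison to the eigenvalues.
   Density is used through limits of derivatives of test functions; identifying
   these limits with the chosen weak derivatives requires the a.e. uniqueness
   of the latter, that is, the fundamental lemma of the calculus of variations,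
   obtained from smooth bumps that increase to the indicator of a box. *)

(** * The functions p(1/x) exp(-1/x) *)

Section flat.
Context {R : realType}.

(** Write r_p = E_(p+1)(u) / E_p(u), so that the Rayleigh quotient for (m,t) is r_(m-t) ... r_(m-1).
    As r is nondecreasing, (i) holds because the t ratios preceding r_m have a product at most
    r_m^t, (ii) because every factor moves up by one index, and (iii) because the geometric mean of
    the last s ratios is at most that of the last t. For a fixed u these are inequalities between
    integer powers; roots enter only with the min-max formula. [weak_partial] picks a representative
    by choice, so its values are linear in u only up to null sets. The energies of u are therefore
    reached as limits of classical energies, along one sequence of test functions that is carried
    through the iterated Laplacian. The bumps must have continuous partial derivatives of every
    order. They are built from a family of functions that differentiation maps to itself, which is
    why a polynomial p accompanies exp(-1/x). *)

Definition flat (p : {poly R}) (x : R) : R :=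
  if 0 < x then p.[x^-1] * expR (- x^-1) else 0.

(** Raise y/n <= 1 + y/n <= exp(y/n) to the n-th power. *)
Lemma exprn_expRN_le (n : nat) (y : R) :
  0 <= y -> y ^+ n * expR (- y) <= n%:R ^+ n.
Proof.
move=> y0; rewrite expRN ler_pdivrMr ?expR_gt0//.
case: n => [|n]; first by rewrite !expr0 mul1r -[leLHS]expR0 ler_expR.
have n0 : 0 < n.+1%:R :> R by rewrite ltr0n.
have -> : y ^+ n.+1 = n.+1%:R ^+ n.+1 * (y / n.+1%:R) ^+ n.+1.
  by rewrite -exprMn mulrCA mulfV ?mulr1 ?gt_eqF.
rewrite ler_pM2l ?exprn_gt0//.
have {2}-> : y = n.+1%:R * (y / n.+1%:R) by rewrite mulrCA mulfV ?mulr1 ?gt_eqF.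
rewrite expRM_natl; apply: lerXn2r.
- by rewrite nnegrE divr_ge0// ltW.
- by rewrite nnegrE expR_ge0.
- by rewrite (le_trans _ (expR_ge1Dx _))// lerDr.
Qed.

(** The factor y^k is there for the induction: the bound for p X + c at k uses the one for p at k +
    1. *)
Lemma horner_expRN_bounded (p : {poly R}) (k : nat) :
  exists C : R, forall y : R, 0 <= y -> y ^+ k * `|p.[y]| * expR (- y) <= C.
Proof.
elim/poly_ind: p k => [|p c IH] k.
  by exists 0 => y _; rewrite horner0 normr0 mulr0 mul0r.
have [C HC] := IH k.+1.
exists (C + `|c| * k%:R ^+ k) => y y0.
rewrite hornerMXaddC.
apply: (@le_trans _ _ (y ^+ k.+1 * `|p.[y]| * expR (- y) +
   `|c| * (y ^+ k * expR (- y)))); last first.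
  by rewrite lerD ?HC// ler_wpM2l// exprn_expRN_le.
have -> : y ^+ k.+1 * `|p.[y]| * expR (- y) + `|c| * (y ^+ k * expR (- y)) =
  y ^+ k * (`|p.[y]| * y + `|c|) * expR (- y) by rewrite exprS; ring.
rewrite ler_wpM2r ?expR_ge0// ler_wpM2l ?exprn_ge0//.
by rewrite (le_trans (ler_normD _ _))// normrM (ger0_norm y0).
Qed.

Lemma flat_le0 p x : x <= 0 -> flat p x = 0.
Proof. by rewrite /flat ltNge => ->. Qed.

(** A quadratic bound makes the difference quotient at 0 at most C |h|, hence the derivative there
    is 0. *)
Lemma flat_bound p : exists C : R, forall x : R, `|flat p x| <= C * x ^+ 2.
Proof.
have [C HC] := horner_expRN_bounded p 2.
exists C => x; rewrite /flat; case: ltP => x0; last first.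
  have C0 : 0 <= C by have := HC 0 (lexx 0); rewrite expr0n/= !mul0r.
  by rewrite normr0 mulr_ge0 ?sqr_ge0.
have xV0 : 0 <= x^-1 by rewrite invr_ge0 ltW.
have := HC _ xV0.
rewrite -mulrA exprVn ler_pdivrMl ?exprn_gt0//.
by rewrite normrM (ger0_norm (expR_ge0 _)) [C * _]mulrC.
Qed.

(** For x > 0 the derivative of p(1/x) exp(-1/x) is (p - p')(1/x) x^-2 exp(-1/x), again a member of
    the family. This single first-order computation yields smoothness of all orders. *)
Lemma is_derive_flat p (x : R) :
  is_derive x 1 (flat p) (flat ('X^2 * (p - p^`())) x).
Proof.
have [x0|x0|->] := ltgtP x 0.
- rewrite flat_le0 ?ltW//.
  apply: (@near_eq_is_derive _ _ _ (cst 0)) => //.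
  near=> y; rewrite flat_le0//=; apply: ltW.
  by near: y; exact: lt_nbhsl.
- apply: (@near_eq_is_derive _ _ _ (fun y : R => p.[y^-1] * expR (- y^-1))).
    near=> y; rewrite /flat ifT//; near: y; exact: lt_nbhsr.
  rewrite /flat x0.
  have xN0 : x != 0 by rewrite gt_eqF.
  have dV : is_derive x 1 (fun y : R => y^-1) (- x ^- 2).
    apply: is_derive_eq; first exact: is_deriveV.
    by rewrite /GRing.scale/= mulr1.
  have d1 := @is_derive1_comp _ (horner p) (fun y : R => y^-1) x _ _
    (is_derive_poly p _) dV.
  have d2 := @is_derive1_comp _ (@expR R) (fun y : R => - y^-1) x _ _
    (is_derive_expR _) (is_deriveN dV).
  apply: is_derive_eq (is_deriveM d1 d2) _.
  rewrite /GRing.scale/= opprK -exprVn !hornerE/=; ring.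
- rewrite flat_le0//.
  have [C HC] := flat_bound p.
  have cv : (fun h : R => h^-1 *: ((flat p \o shift 0) (h *: 1) - flat p 0)) @ 0^' --> 0.
    apply/cvgr0Pnorm_lt => e e0; near=> h.
    have h0 : h != 0 by near: h; exact: nbhs_dnbhs_neq.
    rewrite /= addr0 [h *: 1]mulr1 (flat_le0 _ (lexx 0)) subr0.
    rewrite normrZ normfV ltr_pdivrMl ?normr_gt0//.
    apply: le_lt_trans (HC _) _.
    rewrite -real_normK ?num_real// expr2 mulrA [ltRHS]mulrC ltr_pM2r ?normr_gt0//.
    have : `|h| < e / (`|C| + 1).
      near: h; apply: dnbhs0_lt; rewrite divr_gt0// ltr_wpDl//.
    rewrite ltr_pdivlMr ?ltr_wpDl// => he.
    apply: le_lt_trans he; rewrite mulrC ler_wpM2l//.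
    by rewrite (le_trans (ler_norm _))// lerDl.
  by split; [apply/cvg_ex; exists 0|exact/cvg_lim].
Unshelve. all: by end_near. Qed.

End flat.

(** * Smooth functions *)

Section smooth.
Context {R : realType} {d : nat}.
Implicit Types (f g phi : 'rV[R]_d -> R) (s : seq 'I_d).
Local Notation dir i := (delta_mx ord0 i : 'rV[R]_d).

(** Reduces directional derivatives to one variable, where the chain rule and the fundamental
    theorem of calculus apply. *)
Lemma is_derive_line {V : normedModType R} (f : V -> R) (x v : V) (df : R) :
  is_derive x v f df <-> is_derive (0 : R) 1 (fun h => f (h *: v + x)) df.
Proof.
have E : (fun h : R => h^-1 *: ((f \o shift x) (h *: v) - f x)) =
  (fun h : R => h^-1 *: (((fun h => f (h *: v + x)) \o shift 0) (h *: 1) -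
     f (0 *: v + x))).
  by apply/funext => h /=; rewrite addr0 scale0r add0r [_%:A]mulr1.
by split=> -[dv <-]; split; move: dv; rewrite /derivable/derive E.
Qed.

Lemma is_derive_coord (f : R -> R) (df c e : R) (i j : 'I_d) (x : 'rV[R]_d) :
  is_derive (c * x ord0 i + e) 1 f df ->
  is_derive x (dir j) (fun y => f (c * y ord0 i + e)) (df * (c * (i == j)%:R)).
Proof.
move=> Df; apply/is_derive_line.
pose g (h : R) : R := (c * (i == j)%:R) *: h + (c * x ord0 i + e).
have Dg : is_derive (0 : R) 1 g (c * (i == j)%:R).
  apply: is_derive_eq; rewrite /GRing.scale/= addr0 mulr1//.
have -> : (fun h : R => f (c * (h *: dir j + x) ord0 i + e)) = f \o g.
  apply/funext => h; rewrite /g/= !mxE/= /GRing.scale/=; congr f; ring.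
by apply: is_derive1_comp; rewrite /g scaler0 add0r.
Qed.

(** A coinductive principle: a class of continuous functions stable under each first-order partial
    derivative consists of smooth functions, so iterated derivatives never have to be computed. *)
Lemma smooth_class (P : ('rV[R]_d -> R) -> Prop) :
  (forall f, P f -> continuous f /\ forall i, exists2 g, P g &
     forall x, is_derive x (dir i) f (g x)) ->
  forall f, P f -> smooth f.
Proof.
move=> HP f Pf.
have Ps s : P (partial s f).
  elim: s => [//|i s IH] /=.
  have [_ /(_ i)[g Pg dg]] := HP _ IH.
  by rewrite (_ : (fun x => _) = g)//; apply/funext => x; have [_] := dg x.
move=> s; have [cs ds] := HP _ (Ps s); split=> // i x.
by have [g _ /(_ x)[]] := ds i.
Qed.

Lemma partial_cat s1 s2 phi : partial (s1 ++ s2) phi = partial s1 (partial s2 phi).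
Proof. by rewrite /partial foldr_cat. Qed.

Lemma smooth_partial s phi : smooth phi -> smooth (partial s phi).
Proof. by move=> sphi s'; rewrite -partial_cat; exact: sphi. Qed.

Lemma smooth_continuous phi : smooth phi -> continuous phi.
Proof. by move=> /(_ [::])[]. Qed.

Lemma smooth_is_derive phi i x : smooth phi ->
  is_derive x (dir i) phi (partial [:: i] phi x).
Proof. by move=> /(_ [::])[_ dphi]; apply: derivableP; exact: dphi. Qed.

Lemma is_derive_dirD f g (df dg : R) i x :
  is_derive x (dir i) f df -> is_derive x (dir i) g dg ->
  is_derive x (dir i) (fun y => f y + g y) (df + dg).
Proof. by move=> ? ?; exact: is_deriveD. Qed.

Lemma is_derive_dirZ c f (df : R) i x :
  is_derive x (dir i) f df ->
  is_derive x (dir i) (fun y => c * f y) (c * df).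
Proof. by move=> ?; exact: is_deriveZ. Qed.

Lemma is_derive_dirM f g (df dg : R) i x :
  is_derive x (dir i) f df -> is_derive x (dir i) g dg ->
  is_derive x (dir i) (fun y => f y * g y) (f x * dg + g x * df).
Proof. by move=> ? ?; exact: is_deriveM. Qed.

(** A class for [smooth_class] that contains the bumps: [is_derive_flat] and the Leibniz rule keep
    the derivatives inside it. *)
Inductive flat_algebra : ('rV[R]_d -> R) -> Prop :=
| flat_alg_gen p c e i : flat_algebra (fun x => flat p (c * x ord0 i + e))
| flat_alg_cst a : flat_algebra (cst a)
| flat_algD f g : flat_algebra f -> flat_algebra g ->
    flat_algebra (fun x => f x + g x)
| flat_algM f g : flat_algebra f -> flat_algebra g ->
    flat_algebra (fun x => f x * g x).

Lemma flat_algebra_smooth f : flat_algebra f -> smooth f.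
Proof.
move: f; apply: smooth_class => f; elim=> {f}.
- move=> p c e i; split.
    move=> x; apply: (@continuous_comp _ _ _ (fun x : 'rV[R]_d => c * x ord0 i + e)
       (flat p)).
      apply: (@continuousD _ _ _ (fun x : 'rV[R]_d => c * x ord0 i) (cst e)).
        apply: (@continuousM _ _ (cst c) (fun x : 'rV[R]_d => x ord0 i)).
          exact: cst_continuous.
        exact: coord_continuous.
      exact: cst_continuous.
    apply/differentiable_continuous/derivable1_diffP.
    by have [] := is_derive_flat p (c * x ord0 i + e).
  move=> j; exists (fun x => flat ('X^2 * (p - p^`())) (c * x ord0 i + e) *
      (c * (i == j)%:R)).
    by apply: flat_algM; [exact: flat_alg_gen|exact: flat_alg_cst].
  by move=> x; apply: is_derive_coord; exact: is_derive_flat.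
- move=> a; split; first exact: cst_continuous.
  by move=> i; exists (cst 0); [exact: flat_alg_cst|move=> x; exact: is_derive_cst].
- move=> f g af [cf df] ag [cg dg]; split; first by move=> x; apply: continuousD; [exact: cf|exact: cg].
  move=> i; have [f' af' df'] := df i; have [g' ag' dg'] := dg i.
  exists (fun x => f' x + g' x); first exact: flat_algD.
  by move=> x; exact: is_derive_dirD.
- move=> f g af [cf df] ag [cg dg]; split; first by move=> x; apply: continuousM; [exact: cf|exact: cg].
  move=> i; have [f' af' df'] := df i; have [g' ag' dg'] := dg i.
  exists (fun x => f x * g' x + g x * f' x).
    by apply: flat_algD; exact: flat_algM.
  by move=> x; exact: is_derive_dirM.
Qed.

Lemma smoothD f g : smooth f -> smooth g -> smooth (fun x => f x + g x).
Proof.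
move=> sf sg.
(* All sums of two smooth functions are taken at once, so that the class is stable under
   derivatives. *)
apply: (@smooth_class (fun h => exists f g,
  [/\ smooth f, smooth g & h = (fun x => f x + g x)])); last by exists f, g.
move=> _ [{sf}f [{sg}g [sf sg ->]]]; split.
  by move=> x; apply: continuousD; exact: smooth_continuous.
move=> i; exists (fun x => partial [:: i] f x + partial [:: i] g x).
  by exists (partial [:: i] f), (partial [:: i] g); split=> //; exact: smooth_partial.
by move=> x; apply: is_derive_dirD; exact: smooth_is_derive.
Qed.

Lemma smoothZ c f : smooth f -> smooth (fun x => c * f x).
Proof.
move=> sf.
apply: (@smooth_class (fun h => exists2 f, smooth f & h = (fun x => c * f x)));
  last by exists f.
move=> _ [{sf}f sf ->]; split.
  move=> x; apply: (@continuousM _ _ (cst c) f); first exact: cst_continuous.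
  exact: smooth_continuous.
move=> i; exists (fun x => c * partial [:: i] f x).
  by exists (partial [:: i] f) => //; exact: smooth_partial.
by move=> x; apply: is_derive_dirZ; exact: smooth_is_derive.
Qed.

Lemma smooth_sum (I : Type) (r : seq I) (F : I -> 'rV[R]_d -> R) :
  (forall i, smooth (F i)) -> smooth (fun x => \sum_(i <- r) F i x).
Proof.
move=> sF; elim: r => [|i r IH].
  rewrite (_ : (fun x => _) = cst 0); last by apply/funext => x; rewrite big_nil.
  exact: flat_algebra_smooth (flat_alg_cst 0).
rewrite (_ : (fun x => _) = fun x => F i x + \sum_(i <- r) F i x).
  exact: smoothD.
by apply/funext => x; rewrite big_cons.
Qed.

Lemma partialD s f g : smooth f -> smooth g ->
  partial s (fun x => f x + g x) = fun x => partial s f x + partial s g x.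
Proof.
move=> sf sg; elim: s => [//|i s IH].
rewrite -[i :: s]cat1s !partial_cat IH; apply/funext => x.
suff [_ E] : is_derive x (dir i) (fun x => partial s f x + partial s g x)
  (partial [:: i] (partial s f) x + partial [:: i] (partial s g) x) by exact: E.
by apply: is_derive_dirD; apply: smooth_is_derive; exact: smooth_partial.
Qed.

Lemma partialZ s c f : smooth f ->
  partial s (fun x => c * f x) = fun x => c * partial s f x.
Proof.
move=> sf; elim: s => [//|i s IH].
rewrite -[i :: s]cat1s !partial_cat IH; apply/funext => x.
suff [_ E] : is_derive x (dir i) (fun x => c * partial s f x)
  (c * partial [:: i] (partial s f) x) by exact: E.
by apply: is_derive_dirZ; apply: smooth_is_derive; exact: smooth_partial.
Qed.

Lemma partial_sum s (I : Type) (r : seq I) (F : I -> 'rV[R]_d -> R) :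
  (forall i, smooth (F i)) ->
  partial s (fun x => \sum_(i <- r) F i x) =
  fun x => \sum_(i <- r) partial s (F i) x.
Proof.
move=> sF; elim: r => [|i r IH].
  rewrite (_ : (fun x => _) = fun x => 0 * cst 0 x); last first.
    by apply/funext => x; rewrite big_nil mul0r.
  rewrite partialZ; last exact: flat_algebra_smooth (flat_alg_cst 0).
  by apply/funext => x; rewrite big_nil mul0r.
rewrite (_ : (fun x => _) = fun x => F i x + \sum_(i <- r) F i x); last first.
  by apply/funext => x; rewrite big_cons.
rewrite partialD//; last exact: smooth_sum.
by rewrite IH; apply/funext => x; rewrite big_cons.
Qed.

End smooth.

(** * Boxes and the Borel sigma-algebra *)

Section boxes.
Context {R : realType} {d : nat}.
Implicit Types (l u a b : 'I_d -> R) (f : 'rV[R]_d -> R).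

Definition obox l u : set 'rV[R]_d := [set x | forall i, l i < x ord0 i < u i].

Definition cbox l u : set 'rV[R]_d := [set x | forall i, l i <= x ord0 i <= u i].

Definition orthant l : set 'rV[R]_d := [set x | forall i, l i < x ord0 i].

(** Boxes with rational corners are indexed by [nat] so that a property holding almost everywhere
    for each of them holds almost everywhere for all. Indices that encode nothing get both corners
    at 0. *)
Definition rat_box (n : nat) : ('I_d -> R) * ('I_d -> R) :=
  let q := odflt [ffun=> (0, 0)] (unpickle n : option {ffun 'I_d -> rat * rat}) in
  (fun i => ratr (q i).1, fun i => ratr (q i).2).

Lemma subset_obox_cbox l u : obox l u `<=` cbox l u.
Proof. by move=> x + i => /(_ i) /andP[? ?]; rewrite !ltW. Qed.

Lemma compact_cbox l u : compact (cbox l u).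
Proof.
have := @rV_compact R d (fun i => `[l i, u i]%classic)
  (fun i => @segment_compact _ _ _).
by congr compact; apply/seteqP; split => x /= + i => /(_ i); rewrite in_itv.
Qed.

Lemma measurable_fun_coord (D : set 'rV[R]_d) i :
  measurable_fun D (fun x : 'rV[R]_d => x ord0 i).
Proof. exact: measurable_funTS (@measurable_coord_rV R d i). Qed.

Lemma measurable_forall_coord (P : 'I_d -> set R) :
  (forall i, measurable (P i)) ->
  measurable [set x : 'rV[R]_d | forall i, P i (x ord0 i)].
Proof.
move=> mP.
rewrite (_ : [set x | _] =
  \bigcap_(i in [set: 'I_d]) [set x : 'rV[R]_d | P i (x ord0 i)]).
  apply: fin_bigcap_measurable => // i _.
  by rewrite -[X in measurable X]setTI; exact: measurable_fun_coord.
by apply/seteqP; split => x /= + i => [/(_ i)|/(_ i Logic.I)].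
Qed.

Lemma measurable_obox l u : measurable (obox l u).
Proof.
have := @measurable_forall_coord (fun i => `]l i, u i[%classic)
  (fun i => measurable_itv _).
by congr measurable; apply/seteqP; split => x /= + i => /(_ i); rewrite in_itv.
Qed.

Lemma measurable_cbox l u : measurable (cbox l u).
Proof.
have := @measurable_forall_coord (fun i => `[l i, u i]%classic)
  (fun i => measurable_itv _).
by congr measurable; apply/seteqP; split => x /= + i => /(_ i); rewrite in_itv.
Qed.

Lemma measurable_orthant l : measurable (orthant l).
Proof.
have := @measurable_forall_coord (fun i => `]l i, +oo[%classic)
  (fun i => measurable_itv _).
by congr measurable; apply/seteqP; split => x /= + i => /(_ i);
  rewrite in_itv/= andbT.
Qed.

(** The closed boxes are required to lie in U: they are the compact sets that support the bumps. *)
Lemma open_bigcup_rat_box (U : set 'rV[R]_d) : open U ->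
  U = \bigcup_(n in [set n | cbox (rat_box n).1 (rat_box n).2 `<=` U])
        obox (rat_box n).1 (rat_box n).2.
Proof.
move=> oU; apply/seteqP; split; last first.
  by move=> x [n sU /subset_obox_cbox/sU].
move=> x Ux; have /nbhs_ballP[e e0 eU] : nbhs x U by exact: open_nbhs_nbhs.
have ha i : exists q : rat, x ord0 i - e < ratr q < x ord0 i.
  have [|q] := @rat_in_itvoo _ (x ord0 i - e) (x ord0 i); first by rewrite ltrBlDr ltrDl.
  by rewrite in_itv /= => ?; exists q.
have hb i : exists q : rat, x ord0 i < ratr q < x ord0 i + e.
  have [|q] := @rat_in_itvoo _ (x ord0 i) (x ord0 i + e); first by rewrite ltrDl.
  by rewrite in_itv /= => ?; exists q.
have [a Ha] := choice ha; have [b Hb] := choice hb.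
pose q : {ffun 'I_d -> rat * rat} := [ffun i => (a i, b i)].
have [n E] : exists n, rat_box n = (fun i => ratr (a i), fun i => ratr (b i)).
  exists (pickle q).
  by rewrite /rat_box pickleK/=; congr (_, _); apply/funext => i; rewrite ffunE.
exists n; rewrite ?/mkset ?E/=.
  move=> y Hy; apply: eU; split=> // i j; rewrite (ord1 i).
  have /andP[? ?] := Hy j; have /andP[? ?] := Ha j; have /andP[? ?] := Hb j.
  by rewrite /ball/= ltr_distlC; apply/andP; split; lra.
by move=> i; have /andP[_ ->] := Ha i; have /andP[-> _] := Hb i.
Qed.

Lemma open_measurable_rV (U : set 'rV[R]_d) : open U -> measurable U.
Proof.
move=> /open_bigcup_rat_box ->; apply: bigcup_measurable => n _.
exact: measurable_obox.
Qed.

Lemma continuous_measurable_rV f (D : set 'rV[R]_d) :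
  continuous f -> measurable_fun D f.
Proof.
move=> cf; apply: measurable_funTS.
apply: (measurability _ (measurable_realfun.RGenOpens.measurableE R)).
move=> _ [_ [a [b ->] <-]]; rewrite setTI; apply: open_measurable_rV.
by move/continuousP : cf; apply; exact: interval_open.
Qed.

(** Orthants are stable under intersection, so this set of generators is suited to a Dynkin
    induction. *)
Lemma measurable_rVE :
  @measurable _ 'rV[R]_d = <<s range orthant >>.
Proof.
apply/seteqP; split; last first.
  apply: smallest_sub; first exact: sigma_algebra_measurable.
  by move=> _ [l _ <-]; exact: measurable_orthant.
have mc i : @measurable_fun _ _ (g_sigma_algebraType (range orthant)) R setT
    (fun x => x ord0 i).
  apply: (measurability _ (measurable_realfun.RGenOInfty.measurableE R)) => _ [_ [r ->] <-].
  (* A half-space is exhausted by orthants whose other lower bounds -n tend to minus infinity. *)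
  rewrite setTI (_ : _ @^-1` _ = \bigcup_n
    orthant (fun j => if j == i then r else - n%:R)).
    apply: bigcupT_measurable => n; apply: sub_sigma_algebra.
    by eexists.
  apply/seteqP; split => x; last first.
    by move=> [n _ /(_ i)]; rewrite eqxx/= in_itv/= andbT.
  rewrite /= in_itv/= andbT => xi.
  exists (\max_j Num.bound `|x ord0 j|)%N => //= j.
  case: eqP => [->//|_].
  rewrite ltrNl (le_lt_trans (ler_norm _))// normrN.
  rewrite (lt_le_trans (archi_boundP _))// ler_nat.
  exact: (@leq_bigmax _ (fun j => Num.bound `|x ord0 j|)).
move=> A; apply: smallest_sub; first exact: smallest_sigma_algebra.
rewrite -bigcup_seq; apply: bigcup_sub => i _ _ [Y mY <-].
exact: mc.
Qed.

End boxes.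

(** * The fundamental lemma of the calculus of variations *)

Section bump.
Context {R : realType} {d : nat}.
Local Notation mu := (@lebesgue_rV R d).
Implicit Types (l u : 'I_d -> R) (Omega : set 'rV[R]_d).

(** [flat 1] is exp(-1/y) for y > 0 and 0 elsewhere. Dilation by n + 1 drives each factor to 1
    inside the box and leaves the support unchanged. *)
Definition bump l u (n : nat) (x : 'rV[R]_d) : R :=
  \prod_(i < d) (flat 1 (n.+1%:R * (x ord0 i - l i)) *
                 flat 1 (n.+1%:R * (u i - x ord0 i))).

Lemma flat1_ge0 (y : R) : 0 <= flat 1 y.
Proof. by rewrite /flat; case: ifP => // _; rewrite hornerC mul1r expR_ge0. Qed.

Lemma flat1_le1 (y : R) : flat 1 y <= 1.
Proof.
rewrite /flat; case: ifP => // y0.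
by rewrite hornerC mul1r -expR0 ler_expR oppr_le0 invr_ge0 ltW.
Qed.

Lemma cvg_flat1 (y : R) : 0 < y -> (fun n => flat 1 (n.+1%:R * y)) @ \oo --> (1 : R).
Proof.
move=> y0.
rewrite (_ : (fun n => _) = fun n => expR (- (n.+1%:R^-1 * y^-1))).
  rewrite -[X in _ --> X]expR0.
  apply: continuous_cvg; first exact: continuous_expR.
  rewrite -oppr0 -(mul0r y^-1); apply: cvgN; apply: cvgM.
    exact: cvg_harmonic.
  exact: cvg_cst.
apply/funext => n.
by rewrite /flat mulr_gt0// hornerC mul1r invfM.
Qed.

Lemma bump_ge0 l u n x : 0 <= bump l u n x.
Proof. by apply: prodr_ge0 => i _; rewrite mulr_ge0// flat1_ge0. Qed.

Lemma bump_le1 l u n x : bump l u n x <= 1.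
Proof.
apply: prodr_ile1 => i _; rewrite mulr_ge0 ?flat1_ge0//=.
by rewrite mulr_ile1 ?flat1_ge0 ?flat1_le1.
Qed.

Lemma bump_eq0 l u n x : ~ obox l u x -> bump l u n x = 0.
Proof.
move=> /existsNP[i /negP]; rewrite negb_and -!leNgt => /orP xi.
rewrite /bump (bigD1 i)//= (_ : flat 1 _ * flat 1 _ = 0) ?mul0r//.
case: xi => xi; first by rewrite flat_le0 ?mul0r// pmulr_rle0// subr_le0.
by rewrite [X in _ * X]flat_le0 ?mulr0// pmulr_rle0// subr_le0.
Qed.

Lemma bump_algebra l u n : flat_algebra (bump l u n).
Proof.
rewrite /bump; elim: (index_enum _) => [|i r IH].
  rewrite (_ : (fun x => _) = cst 1); last by apply/funext => x; rewrite big_nil.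
  exact: flat_alg_cst.
pose g i (x : 'rV[R]_d) : R := (flat 1 (n.+1%:R * x ord0 i + - (n.+1%:R * l i)) *
   flat 1 (- n.+1%:R * x ord0 i + n.+1%:R * u i)) *
   \prod_(i <- r) (flat 1 (n.+1%:R * (x ord0 i - l i)) *
                 flat 1 (n.+1%:R * (u i - x ord0 i))).
rewrite [X in flat_algebra X](_ : _ = g i).
  by apply: flat_algM => //; apply: flat_algM; exact: flat_alg_gen.
apply/funext => x; rewrite /g big_cons; congr (flat _ _ * flat _ _ * _); ring.
Qed.

Lemma test_function_bump Omega l u n :
  cbox l u `<=` Omega -> test_function Omega (bump l u n).
Proof.
move=> sO; split; first exact: flat_algebra_smooth (bump_algebra l u n).
exists (cbox l u); split=> // [|x nx]; first exact: compact_cbox.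
by apply: bump_eq0 => /subset_obox_cbox.
Qed.

Lemma cvg_bump l u x : (fun n => bump l u n x) @ \oo --> (\1_(obox l u) x : R).
Proof.
rewrite indicE; have [xB|/negP] := boolP (x \in obox l u); last first.
  rewrite inE => xB; rewrite (_ : (fun n => _) = cst 0); first exact: cvg_cst.
  by apply/funext => n; rewrite bump_eq0.
move: xB; rewrite inE => xB; rewrite /bump.
elim: (index_enum _) => [|i r IH].
  under eq_fun do rewrite big_nil.
  exact: cvg_cst.
under eq_fun do rewrite big_cons.
have /andP[] := xB i; rewrite -subr_gt0 -(subr_gt0 _ (u i)) => h1 h2.
have := cvgM (cvgM (cvg_flat1 h1) (cvg_flat1 h2)) IH.
rewrite !mul1r; exact.
Qed.

End bump.

Section fundamental_lemma.
Context {R : realType} {d : nat}.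
Local Notation mu := (@lebesgue_rV R d).
Implicit Types (l u : 'I_d -> R) (w : 'rV[R]_d -> R).
Variable Omega : set 'rV[R]_d.
Hypothesis oO : open Omega.

Let mO : measurable Omega. Proof. exact: open_measurable_rV. Qed.

(** Test with the bumps of the box and pass to the limit by dominated convergence, with majorant
    |w|. *)
Lemma integral_obox_eq0 w l u : mu.-integrable Omega (EFin \o w) ->
  (forall phi, test_function Omega phi -> \int[mu]_(x in Omega) (w x * phi x) = 0) ->
  cbox l u `<=` Omega -> (\int[mu]_(x in obox l u) (w x)%:E = 0)%E.
Proof.
move=> iw w0 sO.
have sO' : obox l u `<=` Omega by move=> x /subset_obox_cbox/sO.
pose f_ n x := (w x * bump l u n x)%:E.
have mw : measurable_fun Omega w by apply/measurable_EFinP; exact: measurable_int iw.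
have mf n : measurable_fun Omega (f_ n).
  apply/measurable_EFinP; apply: measurable_funM => //.
  apply: continuous_measurable_rV; apply: smooth_continuous.
  exact: flat_algebra_smooth (bump_algebra l u n).
have mf' : measurable_fun Omega (fun x => (w x * \1_(obox l u) x)%:E).
  apply/measurable_EFinP; apply: measurable_funM => //.
  exact: measurable_indic (measurable_obox l u).
have ig : mu.-integrable Omega (fun x => `|(w x)%:E|%E) by exact: integrable_abse.
have cf x : (fun n => f_ n x) @ \oo --> (w x * \1_(obox l u) x)%:E.
  apply: cvg_EFin; first exact: nearW.
  by apply: cvgM; [exact: cvg_cst|exact: cvg_bump].
have df x n : (`|f_ n x| <= `|(w x)%:E|)%E.
  by rewrite lee_fin normrM ler_piMr// ger0_norm ?bump_ge0// bump_le1.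
have [_ _ cI] := dominated_convergence mO mf mf' (aeW _ (fun x _ => cf x)) ig
  (aeW _ (fun x n _ => df x n)).
(* The hypothesis concerns a real-valued integral, that is [fine] of the extended one, and [fine]
   also sends infinity to 0; integrability excludes this case. *)
have I0 n : (\int[mu]_(x in Omega) f_ n x = 0)%E.
  have := w0 _ (test_function_bump n sO); rewrite /Rintegral => /eqP.
  rewrite fine_eq0; first by move/eqP.
  apply: integrable_fin_num => //.
  by apply: (le_integrable mO (mf n) (g := EFin \o w)) => // x _; exact: df.
have : (\int[mu]_(x in Omega) (w x * \1_(obox l u) x)%:E = 0)%E.
  apply: (cvg_unique _ cI) => //.
  rewrite (_ : (fun n => _) = cst 0%E); first exact: cvg_cst.
  by apply/funext => n; rewrite -(I0 n).
rewrite -[in X in _ -> X](setIidr sO') integral_mkcondr => <-.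
apply: eq_integral => x _.
by rewrite patchE indicE; case: ifP => _; rewrite ?mulr1 ?mulr0.
Qed.

(** The sets A with this property form a Dynkin system. It contains the orthants, because an orthant
    cuts the box in a smaller box of the same kind. *)
Lemma integral_subobox_eq0 w l u : mu.-integrable Omega (EFin \o w) ->
  (forall phi, test_function Omega phi -> \int[mu]_(x in Omega) (w x * phi x) = 0) ->
  cbox l u `<=` Omega ->
  forall A, measurable A -> (\int[mu]_(x in A `&` obox l u) (w x)%:E = 0)%E.
Proof.
move=> iw w0 sO.
have mB := measurable_obox l u.
have iB : mu.-integrable (obox l u) (EFin \o w).
  by apply: integrableS iw => // x /subset_obox_cbox/sO.
have iA A : measurable A -> mu.-integrable (A `&` obox l u) (EFin \o w).
  by move=> mA; apply: integrableS iB => //; exact: measurableI.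
have IB : (\int[mu]_(x in obox l u) (w x)%:E = 0)%E by exact: integral_obox_eq0.
move=> A mA; move: (mA); rewrite measurable_rVE.
move: A {mA}; apply: (dynkin_induction measurable_rVE).
- move=> _ _ [l1 _ <-] [l2 _ <-].
  exists (fun i => Num.max (l1 i) (l2 i)) => //.
  apply/seteqP; split => x /=.
    by move=> h; split=> i; have := h i; rewrite gt_max => /andP[].
  by move=> [h1 h2] i; rewrite gt_max h1 h2.
- by rewrite setTI.
- move=> _ [l' _ <-].
  rewrite (_ : _ `&` _ = obox (fun i => Num.max (l i) (l' i)) u).
    apply: integral_obox_eq0 => // x xB; apply: sO => i.
    by have := xB i; rewrite ge_max => /andP[/andP[-> _] ->].
  apply/seteqP; split => x /=.
    by move=> [h1 h2] i; have := h2 i; rewrite gt_max (h1 i) => /andP[-> ->].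
  move=> h; split=> i; have := h i; rewrite gt_max => /andP[/andP[h1 h2] h3] //.
  by rewrite h1.
- move=> S mS IS; move: IB.
  have {1}<- : (S `&` obox l u) `|` (~` S `&` obox l u) = obox l u.
    by rewrite -setIUl setUCr setTI.
  rewrite integral_setU ?IS ?add0e//.
  + exact: measurableI.
  + by apply: measurableI => //; exact: measurableC.
  + by rewrite -setIUl setUCr setTI; exact: measurable_int iB.
  + by apply/disj_setPS => x [[? _] []].
- move=> F mF tF IF.
  rewrite setI_bigcupl integral_bigcup.
  + by rewrite eseries0// => i _ _; exact: IF.
  + exact: trivIset_setIr.
  + by move=> k; exact: measurableI.
  + rewrite -setI_bigcupl; apply: iA; exact: bigcup_measurable.
Qed.

(** On a box in [Omega] the integral of w over every measurable subset is 0, hence w = 0 almost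
    everywhere there; countably many such boxes cover [Omega]. *)
Lemma null_on_test_functions w : mu.-integrable Omega (EFin \o w) ->
  (forall phi, test_function Omega phi -> \int[mu]_(x in Omega) (w x * phi x) = 0) ->
  null_on Omega w.
Proof.
move=> iw w0.
have h n : \forall x \ae mu, cbox (rat_box n).1 (rat_box n).2 `<=` Omega ->
    obox (rat_box n).1 (rat_box n).2 x -> w x = 0.
  have [sO|nsO] := pselect (cbox (@rat_box R d n).1 (rat_box n).2 `<=` Omega);
    last exact: aeW.
  have mB := measurable_obox (@rat_box R d n).1 (rat_box n).2.
  have : ae_eq mu (obox (@rat_box R d n).1 (rat_box n).2) (EFin \o w) (cst 0%E).
    apply: integral_ae_eq => //.
      by apply: integrableS iw => // x /subset_obox_cbox/sO.
    move=> E sE mE; rewrite integral0 -(setIidl sE).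
    exact: integral_subobox_eq0.
  by apply: filterS => x wx _ /wx[].
have := ae_foralln h; apply: filterS => x wx.
by rewrite [X in X x -> _](open_bigcup_rat_box oO) => -[n /wx]; exact.
Qed.

End fundamental_lemma.

(** * Integration by parts *)

Section cons_rV.
Context {R : realType}.

Lemma continuous_rV {T : topologicalType} n (F : T -> 'rV[R]_n) :
  (forall i, continuous (fun t => F t ord0 i)) -> continuous F.
Proof.
move=> cF t; apply/cvg_ballP => e e0.
have : \forall s \near t, forall j, ball (F t ord0 j) e (F s ord0 j).
  by apply: filter_forall => j; have /cvg_ballP := cF j t; exact.
by apply: filterS => s Fs; split=> // i j; rewrite (ord1 i).
Qed.

Lemma cons_rV_dir0 n (h x : R) (y : 'rV[R]_n) :
  cons_rV (h + x, y) = h *: delta_mx ord0 ord0 + cons_rV (x, y).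
Proof.
apply/rowP => k; rewrite [RHS]mxE [X in _ = X + _]mxE [delta_mx _ _ _ _]mxE; have [j ->|->] := unliftP ord0 k.
  by rewrite !cons_rVS [lift _ _ == _]eq_sym (negbTE (neq_lift _ _)) andbF mulr0 add0r.
by rewrite !cons_rV0 !eqxx mulr1.
Qed.

Lemma cons_rV_dirS n j (h x : R) (y : 'rV[R]_n) :
  cons_rV (x, h *: delta_mx ord0 j + y) =
  h *: delta_mx ord0 (lift ord0 j) + cons_rV (x, y).
Proof.
apply/rowP => k; rewrite [RHS]mxE [X in _ = X + _]mxE [delta_mx _ _ _ _]mxE.
have [j' ->|->] := unliftP ord0 k.
  by rewrite !cons_rVS (inj_eq lift_inj) !mxE.
by rewrite !cons_rV0 (negbTE (neq_lift _ _)) andbF mulr0 add0r.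
Qed.

Lemma continuous_cons_rVl n (y : 'rV[R]_n) : continuous (fun x : R => cons_rV (x, y)).
Proof.
apply: continuous_rV => k; have [j ->|->] := unliftP ord0 k.
  by under eq_fun do rewrite cons_rVS; exact: cst_continuous.
by under eq_fun do rewrite cons_rV0; move=> x; exact: cvg_id.
Qed.

Lemma continuous_cons_rVr n (x : R) :
  continuous (fun y : 'rV[R]_n => cons_rV (x : measurableTypeR R, y)).
Proof.
apply: continuous_rV => k; have [j ->|->] := unliftP ord0 k.
  under eq_fun do rewrite cons_rVS; exact: coord_continuous.
by under eq_fun do rewrite cons_rV0; exact: cst_continuous.
Qed.

Lemma lebesgue_rV_cbox_lty n (l u : 'I_n -> R) :
  (lebesgue_rV n (cbox l u) < +oo)%E.
Proof.
elim: n l u => [|n IH] l u; first by rewrite /= /dirac/= ltry.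
rewrite /= /lebesgue_rV_step /pushforward.
have -> : @cons_rV R n @^-1` cbox l u =
    `[l ord0, u ord0] `*` cbox (fun j => l (lift ord0 j)) (fun j => u (lift ord0 j)).
  apply/seteqP; split => -[x y] /=.
    move=> h; split => [|j]; first by have := h ord0; rewrite cons_rV0 in_itv.
    by have := h (lift ord0 j); rewrite cons_rVS.
  move=> [+ h] i; rewrite in_itv/=; have [j ->|->] := unliftP ord0 i => ?.
    by rewrite cons_rVS; exact: h.
  by rewrite cons_rV0.
rewrite product_measure1E//=; last exact: measurable_cbox.
apply: lte_mul_pinfty => //.
by rewrite lebesgue_measure_itv/=; case: ifP.
Qed.

End cons_rV.

(** * Vanishing of the integral of a derivative with bounded support *)

Section divergence.
Context {R : realType}.

Lemma integral_is_derive_eq0 (h dh : R -> R) (M : R) :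
  (forall x : R, is_derive x (1 : R) h (dh x)) -> continuous dh ->
  (forall x, M < `|x| -> h x = 0) ->
  (\int[lebesgue_measure]_x (dh x)%:E = 0)%E.
Proof.
move=> hdh cdh h0.
have dh0 x : M < `|x| -> dh x = 0.
  move=> Mx; have [_ <-] := hdh x.
  rewrite (@near_eq_derive _ _ _ _ (cst 0)) ?derive_cst//.
  have : \forall y \near x, M < `|y|.
    have := @norm_continuous _ R x; move=> /cvgr_gt; exact.
  by apply: filterS => y; exact: h0.
(* N exceeds M and is positive even when M is negative, so [-N, N] is a proper interval with h = 0
   at both ends. *)
pose N : R := `|M| + 1.
have N0 : 0 < N by rewrite ltr_wpDl.
have MN : M < N by rewrite (le_lt_trans (ler_norm _))// ltrDl.
have -> : (\int[lebesgue_measure]_x (dh x)%:E =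
   \int[lebesgue_measure]_(x in `[(- N)%R, N]) (dh x)%:E)%E.
  rewrite [RHS]integral_mkcond; apply: eq_integral => x _; rewrite patchE.
  case: ifPn => //; rewrite notin_setE/= in_itv/= -ler_norml => /negP.
  by rewrite -ltNge => Nx; rewrite dh0// (lt_trans MN).
have ch : continuous h.
  by move=> x; apply/differentiable_continuous/derivable1_diffP; have [] := hdh x.
rewrite (@continuous_FTC2 _ dh h).
- by rewrite !h0 ?subee// ?normrN gtr0_norm.
- by rewrite gtrN.
- exact: continuous_subspaceT.
- split.
  + by move=> x _; have [] := hdh x.
  + exact/cvg_at_right_filter/ch.
  + exact/cvg_at_left_filter/ch.
- by move=> x _; rewrite derive1E; have [] := hdh x.
Qed.

Lemma derive_eq0_off n (f g : 'rV[R]_n -> R) i (K : set 'rV[R]_n) : closed K ->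
  (forall x, is_derive x (delta_mx ord0 i) f (g x)) ->
  (forall x, ~ K x -> f x = 0) -> forall x, ~ K x -> g x = 0.
Proof.
move=> cK fg f0 x nx; have [_ <-] := fg x.
rewrite (@near_eq_derive _ _ _ _ (cst 0)) ?derive_cst//.
have : \forall y \near x, (~` K) y.
  by apply: open_nbhs_nbhs; split => //; exact: closed_openC.
by apply: filterS => y; exact: f0.
Qed.

Lemma closed_compact_rV n (K : set 'rV[R]_n) : compact K -> closed K.
Proof. by apply: compact_closed; exact: norm_hausdorff. Qed.

Lemma compact_sub_cbox n (K : set 'rV[R]_n) : compact K ->
  exists M : R, K `<=` cbox (fun=> - M) (fun=> M).
Proof.
move=> /compact_bounded[M [_ HM]]; exists (M + 1) => x Kx i.
rewrite -ler_norml; apply: le_trans (HM (M + 1) _ x Kx); last by rewrite ltrDl.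
rewrite [leRHS]mx_normrE.
exact: (le_bigmax _ (fun ij : 'I_1 * 'I_n => `|x ij.1 ij.2|) (ord0, i)).
Qed.

Lemma integrable_continuous_cbox n (g : 'rV[R]_n -> R) (l u : 'I_n -> R) :
  continuous g -> (forall x, ~ cbox l u x -> g x = 0) ->
  (lebesgue_rV n).-integrable setT (EFin \o g).
Proof.
move=> cg g0.
have mB := measurable_cbox l u.
have : (lebesgue_rV n).-integrable (cbox l u) (EFin \o g).
  apply: measurable_bounded_integrable => //.
  - exact: lebesgue_rV_cbox_lty.
  - exact: continuous_measurable_rV.
  - have : compact (g @` cbox l u).
      apply: continuous_compact; last exact: compact_cbox.
      exact: continuous_subspaceT.
    move=> /compact_bounded[M [Mr HM]]; exists M; split => // y My x Bx.
    by apply: HM => //; exists x.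
rewrite (integrable_mkcond _ mB); apply: eq_integrable => // x _.
rewrite patchE; case: ifPn => //; rewrite notin_setE => nx.
by rewrite /= g0.
Qed.

Lemma integrable_continuous_compact n (g : 'rV[R]_n -> R) (K D : set 'rV[R]_n) :
  measurable D -> compact K -> continuous g -> (forall x, ~ K x -> g x = 0) ->
  (lebesgue_rV n).-integrable D (EFin \o g).
Proof.
move=> mD /compact_sub_cbox[M KM] cg g0.
apply: (@integrableS _ _ _ _ setT) => //.
by apply: (integrable_continuous_cbox (l := fun=> - M) (u := fun=> M)) => // x nx;
  apply: g0 => /KM.
Qed.

(** Induction along the recursive construction of the measure, with Fubini. If i is the first
    coordinate, the inner integral is taken over it and vanishes by the one-variable case; otherwise
    it is taken over the remaining coordinates and vanishes by induction. Boxes are used because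
    their slices are boxes. *)
Lemma integral_dir_derive_eq0 n (f g : 'rV[R]_n -> R) i (l u : 'I_n -> R) :
  (forall x, is_derive x (delta_mx ord0 i) f (g x)) -> continuous g ->
  (forall x, ~ cbox l u x -> f x = 0) ->
  (\int[lebesgue_rV n]_x (g x)%:E = 0)%E.
Proof.
elim: n f g i l u => [|n IH] f g i l u; first by case: i.
move=> fg cg f0.
have g0 := derive_eq0_off (closed_compact_rV (@compact_cbox _ _ l u)) fg f0.
have ig := integrable_continuous_cbox cg g0.
have mg : measurable_fun setT (EFin \o g).
  by apply/measurable_EFinP; exact: continuous_measurable_rV.
have mc := @measurable_cons_rV R n.
have igc : (lebesgue_measure \x lebesgue_rV n)%E.-integrable setT
    (EFin \o g \o @cons_rV R n).
  apply/integrableP; split; first exact: measurableT_comp.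
  move/integrableP: ig => [_]; apply: le_lt_trans.
  rewrite /= /lebesgue_rV_step.
  rewrite (ge0_integral_pushforward mc)//.
  apply/measurable_EFinP; apply: continuous_measurable_rV => x.
  by apply: continuous_comp; [exact: cg|exact: norm_continuous].
rewrite /= /lebesgue_rV_step (integral_pushforward mc)//.
rewrite preimage_setT.
have [j ij|i0] := unliftP ord0 i.
- rewrite -integral12_prod_meas1//; apply: integral0_eq => x _.
  rewrite /fubini_F.
  apply: (IH (fun y => f (cons_rV (x, y))) (fun y => g (cons_rV (x, y))) j
    (fun j => l (lift ord0 j)) (fun j => u (lift ord0 j))).
  + move=> y; apply/is_derive_line.
    under eq_fun do rewrite cons_rV_dirS -ij.
    by have /is_derive_line := fg (cons_rV (x, y)).
  + move=> y; apply: continuous_comp; last exact: cg.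
    exact: continuous_cons_rVr.
  + move=> y ny; apply: f0 => xB; apply: ny => k.
    by have := xB (lift ord0 k); rewrite cons_rVS.
- rewrite -integral21_prod_meas1//; apply: integral0_eq => y _.
  rewrite /fubini_G.
  (* The last argument bounds |x| for every x between [l ord0] and [u ord0]. *)
  apply: (@integral_is_derive_eq0 (fun x => f (cons_rV (x, y)))
     (fun x => g (cons_rV (x, y))) (`|l ord0| + `|u ord0|)).
  + move=> x; apply/is_derive_line.
    under eq_fun do rewrite [_ *: 1]mulr1 cons_rV_dir0 -i0.
    by have /is_derive_line := fg (cons_rV (x, y)).
  + move=> x; apply: continuous_comp; last exact: cg.
    exact: continuous_cons_rVl.
  + move=> x xlu; apply: f0 => xB; move: xlu; apply/negP; rewrite -leNgt.
    have := xB ord0; rewrite cons_rV0/= ler_norml => /andP[lx xu].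
    apply/andP; split.
      have := ler_norm (- l ord0); rewrite normrN; have := normr_ge0 (u ord0); lra.
    by have := ler_norm (u ord0); have := normr_ge0 (l ord0); lra.
Qed.

End divergence.

(** * The space L^2 *)

Section L2.
Context {R : realType} {d : nat}.
Local Notation mu := (@lebesgue_rV R d).
Implicit Types (u v w f g : 'rV[R]_d -> R) (F G : nat -> 'rV[R]_d -> R).
Variable Omega : set 'rV[R]_d.
Hypothesis mO : measurable Omega.
Local Notation L2 := (L2 Omega).

Definition dot f g : R := \int[mu]_(x in Omega) (f x * g x).

(** From (|f| - |g|)^2 >= 0 one gets |f g| <= f^2 + g^2. *)
Lemma L2_integrableM f g : L2 f -> L2 g ->
  mu.-integrable Omega (EFin \o (fun x => f x * g x)).
Proof.
move=> [mf fi] [mg gi].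
have i2 (h : 'rV[R]_d -> R) : measurable_fun Omega h -> (\int[mu]_(x in Omega) (h x ^+ 2)%:E < +oo)%E ->
    mu.-integrable Omega (fun x => (h x ^+ 2)%:E).
  move=> mh hi; apply/integrableP; split.
    by apply/measurable_EFinP; exact: measurable_funX.
  rewrite (eq_integral (fun x => (h x ^+ 2)%:E))// => x _.
  by rewrite gee0_abs// lee_fin sqr_ge0.
apply: (le_integrable mO _ _ (integrableD mO (i2 _ mf fi) (i2 _ mg gi))).
  by apply/measurable_EFinP; exact: measurable_funM.
move=> x _; rewrite lee_fin normrM -(real_normK (num_real (f x)))
  -(real_normK (num_real (g x))) [leRHS]ger0_norm; last by rewrite addr_ge0 ?sqr_ge0.
have := sqr_ge0 (`|f x| - `|g x|); rewrite sqrrB.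
have := sqr_ge0 `|f x|; have := sqr_ge0 `|g x|; lra.
Qed.

Lemma L2_of_integrable f : measurable_fun Omega f ->
  mu.-integrable Omega (EFin \o (fun x => f x * f x)) -> L2 f.
Proof.
move=> mf /integrableP[_ fi]; split=> //; apply: le_lt_trans fi.
apply: ge0_le_integral => //.
- by move=> x _; rewrite lee_fin sqr_ge0.
- by apply/measurable_EFinP; exact: measurable_funX.
- apply/measurable_EFinP; apply: measurableT_comp => //.
  exact: measurable_funM.
- by move=> x _ /=; rewrite -expr2 ger0_norm// sqr_ge0.
Qed.

Lemma L2D f g : L2 f -> L2 g -> L2 (fun x => f x + g x).
Proof.
move=> Lf Lg; have [mf _] := Lf; have [mg _] := Lg.
apply: L2_of_integrable; first exact: measurable_funD.
apply: (eq_integrable mO _ _ _ (integrableD mO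
  (integrableD mO (L2_integrableM Lf Lf) (L2_integrableM Lg Lg))
  (integrableD mO (L2_integrableM Lf Lg) (L2_integrableM Lf Lg)))) => x _ /=.
by rewrite -!EFinD; congr EFin; ring.
Qed.

Lemma L2Z c f : L2 f -> L2 (fun x => c * f x).
Proof.
move=> Lf; have [mf _] := Lf.
apply: L2_of_integrable; first exact: measurable_funM.
apply: (eq_integrable mO _ _ _ (integrableZl mO (c * c) (L2_integrableM Lf Lf))) => x _ /=.
by rewrite -EFinM; congr EFin; ring.
Qed.

Lemma L2B f g : L2 f -> L2 g -> L2 (fun x => f x - g x).
Proof.
move=> Lf /(L2Z (-1)) Lg; have := L2D Lf Lg.
by rewrite (_ : (fun x => _) = fun x => f x - g x)//; apply/funext => x; rewrite mulN1r.
Qed.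

Lemma L2_0 : L2 (cst 0).
Proof.
split; first exact: measurable_cst.
by under eq_integral do rewrite expr0n/=; rewrite integral0.
Qed.

Lemma L2_sum (I : Type) (r : seq I) (f : I -> 'rV[R]_d -> R) :
  (forall i, L2 (f i)) -> L2 (fun x => \sum_(i <- r) f i x).
Proof.
move=> Lf; elim: r => [|i r IH].
  by under eq_fun do rewrite big_nil; exact: L2_0.
by under eq_fun do rewrite big_cons; exact: L2D.
Qed.

Lemma dotC f g : dot f g = dot g f.
Proof. by apply: eq_Rintegral => x _; rewrite mulrC. Qed.

Lemma dotDl f g h : L2 f -> L2 g -> L2 h ->
  dot (fun x => f x + g x) h = dot f h + dot g h.
Proof.
move=> Lf Lg Lh; rewrite /dot -RintegralD//; try exact: L2_integrableM.
by apply: eq_Rintegral => x _; rewrite mulrDl.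
Qed.

Lemma dotZl c f g : L2 f -> L2 g -> dot (fun x => c * f x) g = c * dot f g.
Proof.
move=> Lf Lg; rewrite /dot -RintegralZl//; last exact: L2_integrableM.
by apply: eq_Rintegral => x _; rewrite mulrA.
Qed.

Lemma dotBl f g h : L2 f -> L2 g -> L2 h ->
  dot (fun x => f x - g x) h = dot f h - dot g h.
Proof.
move=> Lf Lg Lh; rewrite /dot -RintegralB//; try exact: L2_integrableM.
by apply: eq_Rintegral => x _; rewrite mulrBl.
Qed.

Lemma dot_ge0 f : 0 <= dot f f.
Proof. by apply: Rintegral_ge0 => x _; rewrite -expr2 sqr_ge0. Qed.

Lemma discriminant_le0 (a b c : R) :
  (forall t, 0 <= a + 2 * t * b + t ^+ 2 * c) -> b ^+ 2 <= a * c.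
Proof.
move=> H.
have [c0|c0|c0] := ltgtP c 0; last rewrite {}c0 in H *.
- have [a0|a0] := ltP 0 a.
    exfalso; have t2 : 0 < - a / c by rewrite mulNr oppr_gt0 pmulr_rlt0 ?invr_lt0.
    (* Then t^2 c = -2a, and the values of the polynomial at t and -t add up to -2a < 0. *)
    pose t := Num.sqrt (2 * (- a / c)).
    have tt : t ^+ 2 * c = - 2 * a.
      rewrite sqr_sqrtr; last by rewrite mulr_ge0// ltW.
      by field; rewrite lt_eqF.
    have := H t; have := H (- t); rewrite sqrrN tt; lra.
  have a0' : a = 0 by apply/eqP; rewrite eq_le a0; have := H 0; lra.
  have := H 1; have := H (-1); rewrite a0'; lra.
(* Evaluation at the minimum of the parabola. *)
- have := H (- b / c); have -> : a + 2 * (- b / c) * b + (- b / c) ^+ 2 * c =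
    a - b ^+ 2 / c by field; rewrite gt_eqF.
  by rewrite subr_ge0 ler_pdivrMr.
- rewrite mulr0; have [->|b0] := eqVneq b 0; first by rewrite expr0n.
  (* At this point the affine function a + 2 t b takes the value -1. *)
  have := H (- (a + 1) / (2 * b)); rewrite mulr0 addr0.
  have -> : 2 * (- (a + 1) / (2 * b)) * b = - (a + 1) by field.
  by lra.
Qed.

Lemma dot_quadratic f g t : L2 f -> L2 g ->
  dot (fun x => f x + t * g x) (fun x => f x + t * g x) =
  dot f f + 2 * t * dot f g + t ^+ 2 * dot g g.
Proof.
move=> Lf Lg; have Lt := L2Z t Lg; have Ls := L2D Lf Lt.
have E h : L2 h -> dot (fun x => f x + t * g x) h = dot f h + t * dot g h.
  by move=> Lh; rewrite dotDl// dotZl.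
rewrite E// (dotC f) (dotC g) !E// (dotC g f); ring.
Qed.

(** Cauchy-Schwarz for vector fields, meant for the gradients in the energies of odd order. *)
Lemma sum_dot_CauchySchwarz (I : Type) (r : seq I) (f g : I -> 'rV[R]_d -> R) :
  (forall i, L2 (f i)) -> (forall i, L2 (g i)) ->
  (\sum_(i <- r) dot (f i) (g i)) ^+ 2 <=
  (\sum_(i <- r) dot (f i) (f i)) * (\sum_(i <- r) dot (g i) (g i)).
Proof.
move=> Lf Lg; apply: discriminant_le0 => t.
rewrite !mulr_sumr -!big_split/=; apply: sumr_ge0 => i _.
by rewrite -dot_quadratic// dot_ge0.
Qed.

Lemma dot_CauchySchwarz f g : L2 f -> L2 g -> dot f g ^+ 2 <= dot f f * dot g g.
Proof.
by move=> Lf Lg; apply: discriminant_le0 => t; rewrite -dot_quadratic// dot_ge0.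
Qed.

Lemma dot_ae f g h : L2 f -> L2 g -> L2 h -> null_on Omega (fun x => f x - g x) ->
  dot f h = dot g h.
Proof.
move=> Lf Lg Lh fg; rewrite /dot /Rintegral; congr fine.
apply: ae_eq_integral => //.
- by apply: measurable_int; exact: L2_integrableM.
- by apply: measurable_int; exact: L2_integrableM.
by apply: filterS fg => x /[swap] Ox /(_ Ox)/subr0_eq ->.
Qed.

Lemma cvg_seq_eq (a : nat -> R) (b c : R) : a @ \oo --> b -> b = c -> a @ \oo --> c.
Proof. by move=> + <-. Qed.

Definition cvgL2 F u :=
  (fun n => dot (fun x => F n x - u x) (fun x => F n x - u x)) @ \oo --> (0 : R).

Lemma cvg0_sqr_le (a b : nat -> R) c : (forall n, a n ^+ 2 <= b n * c) ->
  b @ \oo --> (0 : R) -> a @ \oo --> (0 : R).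
Proof.
move=> ab b0; have bc : (fun n => b n * c) @ \oo --> (0 : R).
  by rewrite -(mul0r c); apply: cvgM => //; exact: cvg_cst.
apply/cvgr0Pnorm_lt => e e0.
have e2 : 0 < e ^+ 2 by rewrite exprn_gt0.
move/cvgr0Pnorm_lt : bc => /(_ _ e2); apply: filterS => n bn.
rewrite -(ltr_pXn2r (ltn0Sn 1)) ?nnegrE ?normr_ge0 ?(ltW e0)//.
rewrite real_normK ?num_real//; apply: le_lt_trans (ab n) _.
exact: le_lt_trans (ler_norm _) bn.
Qed.

Lemma cvgL2_dot F u g : (forall n, L2 (F n)) -> L2 u -> L2 g -> cvgL2 F u ->
  (fun n => dot (F n) g) @ \oo --> dot u g.
Proof.
move=> LF Lu Lg Fu; apply: (@cvg_sub0 _ _ _ _ _ _ (cst (dot u g))); last exact: cvg_cst.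
rewrite (_ : _ - _ = fun n => dot (fun x => F n x - u x) g); last first.
  by apply/funext => n; rewrite dotBl.
apply: (@cvg0_sqr_le _ _ (dot g g) _ Fu) => n.
by apply: dot_CauchySchwarz => //; exact: L2B.
Qed.

Lemma cvgL2_sqr F u : (forall n, L2 (F n)) -> L2 u -> cvgL2 F u ->
  (fun n => dot (F n) (F n)) @ \oo --> dot u u.
Proof.
move=> LF Lu Fu.
rewrite (_ : (fun n => _) = fun n => dot (fun x => F n x - u x) (fun x => F n x - u x) +
    2 * dot (F n) u - dot u u).
  apply: (@cvg_seq_eq _ (0 + 2 * dot u u - dot u u)); last by ring.
  apply: cvgB; last exact: cvg_cst.
  apply: cvgD => //; apply: cvgM; [exact: cvg_cst|exact: cvgL2_dot].
apply/funext => n; have LB := L2B (LF n) Lu.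
rewrite dotBl// (dotC (F n)) (dotC u (fun x => F n x - u x)) !dotBl// (dotC u (F n)).
by ring.
Qed.

Lemma cvgL2D F G u v : (forall n, L2 (F n)) -> (forall n, L2 (G n)) -> L2 u -> L2 v ->
  cvgL2 F u -> cvgL2 G v -> cvgL2 (fun n x => F n x + G n x) (fun x => u x + v x).
Proof.
move=> LF LG Lu Lv Fu Gv.
pose f n := fun x => F n x - u x; pose g n := fun x => G n x - v x.
have Lf n : L2 (f n) by exact: L2B.
have Lg n : L2 (g n) by exact: L2B.
have fg : (fun n => dot (f n) (g n)) @ \oo --> (0 : R).
  apply: (@cvg0_sqr_le _ (fun n => dot (f n) (f n) * dot (g n) (g n)) 1).
    by move=> n; rewrite mulr1; exact: dot_CauchySchwarz.
  by apply: cvg_seq_eq (mulr0 0); exact: cvgM.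
rewrite /cvgL2 (_ : (fun n => _) = fun n =>
    dot (f n) (f n) + 2 * dot (f n) (g n) + dot (g n) (g n)).
  apply: (@cvg_seq_eq _ (0 + 2 * 0 + 0)); last by ring.
  apply: cvgD => //; apply: cvgD => //; apply: cvgM => //; exact: cvg_cst.
apply/funext => n.
rewrite (_ : dot _ _ = dot (fun x => f n x + 1 * g n x) (fun x => f n x + 1 * g n x)).
  by rewrite dot_quadratic//; ring.
by apply: eq_Rintegral => x _; rewrite /f /g; ring.
Qed.

Lemma cvgL2Z c F u : (forall n, L2 (F n)) -> L2 u ->
  cvgL2 F u -> cvgL2 (fun n x => c * F n x) (fun x => c * u x).
Proof.
move=> LF Lu Fu; rewrite /cvgL2 (_ : (fun n => _) = fun n =>
    c * c * dot (fun x => F n x - u x) (fun x => F n x - u x)).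
  by apply: cvg_seq_eq (mulr0 (c * c)); apply: cvgM => //; exact: cvg_cst.
apply/funext => n; have LB := L2B (LF n) Lu.
rewrite /dot -RintegralZl//; last exact: L2_integrableM.
by apply: eq_Rintegral => x _; ring.
Qed.

Lemma cvgL2_sum (I : Type) (r : seq I) (F : I -> nat -> 'rV[R]_d -> R)
    (u : I -> 'rV[R]_d -> R) :
  (forall i n, L2 (F i n)) -> (forall i, L2 (u i)) ->
  (forall i, cvgL2 (F i) (u i)) ->
  cvgL2 (fun n x => \sum_(i <- r) F i n x) (fun x => \sum_(i <- r) u i x).
Proof.
move=> LF Lu Fu; elim: r => [|i r IH].
  rewrite /cvgL2 (_ : (fun n => _) = cst 0); first exact: cvg_cst.
  apply/funext => n; rewrite /dot (@eq_Rintegral _ _ _ _ _ (cst 0)).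
    by rewrite /Rintegral integral0.
  by move=> x _; rewrite !big_nil subrr mulr0.
rewrite (_ : (fun n x => _) = fun n x => F i n x + \sum_(i <- r) F i n x); last first.
  by apply/funext => n; apply/funext => x; rewrite big_cons.
rewrite (_ : (fun x => _) = fun x => u i x + \sum_(i <- r) u i x); last first.
  by apply/funext => x; rewrite big_cons.
by apply: cvgL2D => //; [move=> n; exact: L2_sum|exact: L2_sum].
Qed.

Lemma cvgL2_ae F u v : (forall n, L2 (F n)) -> L2 u -> L2 v ->
  null_on Omega (fun x => u x - v x) -> cvgL2 F u -> cvgL2 F v.
Proof.
move=> LF Lu Lv uv; rewrite /cvgL2; set a := (X in X @ _ --> _ -> _).
set b := (X in _ -> X @ _ --> _); suff -> : b = a by [].
apply/funext => n; rewrite /a /b.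
have LBu := L2B (LF n) Lu; have LBv := L2B (LF n) Lv.
have uv' : null_on Omega (fun x => (F n x - u x) - (F n x - v x)).
  by apply: filterS uv => x /[swap] Ox /(_ Ox)/subr0_eq ->; rewrite subrr.
by rewrite (dot_ae LBu LBv LBu uv') (dotC (fun x => F n x - v x))
  (dot_ae LBu LBv LBv uv').
Qed.

End L2.

(** * Weak derivatives *)

Section weak.
Context {R : realType} {d : nat}.
Local Notation mu := (@lebesgue_rV R d).
Implicit Types (u v w f g phi psi : 'rV[R]_d -> R) (F G : nat -> 'rV[R]_d -> R)
  (s : seq 'I_d).
Variable Omega : set 'rV[R]_d.
Hypothesis oO : open Omega.
Hypothesis fO : (mu Omega < +oo)%E.
Local Notation L2 := (L2 Omega).
Local Notation dot := (dot Omega).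
Local Notation cvgL2 := (cvgL2 Omega).
Local Notation test := (test_function Omega).

Let mO : measurable Omega. Proof. exact: open_measurable_rV. Qed.

Lemma testD phi psi : test phi -> test psi -> test (fun x => phi x + psi x).
Proof.
move=> [sphi [K [cK KO phi0]]] [spsi [K' [cK' KO' psi0]]]; split; first exact: smoothD.
exists (K `|` K'); split; first exact: compactU.
  by move=> x [/KO|/KO'].
by move=> x /not_orP[nK nK']; rewrite phi0// psi0// addr0.
Qed.

Lemma testZ c phi : test phi -> test (fun x => c * phi x).
Proof.
move=> [sphi [K [cK KO phi0]]]; split; first exact: smoothZ.
by exists K; split=> // x /phi0 ->; rewrite mulr0.
Qed.

Lemma test_sum (I : Type) (r : seq I) (f : I -> 'rV[R]_d -> R) :
  (forall i, test (f i)) -> test (fun x => \sum_(i <- r) f i x).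
Proof.
move=> tf; elim: r => [|i r IH].
  under eq_fun do rewrite big_nil; split; first exact: flat_algebra_smooth (flat_alg_cst 0).
  by exists set0; split => //; exact: compact0.
by under eq_fun do rewrite big_cons; exact: testD.
Qed.

Lemma test_partial s phi : test phi -> test (partial s phi).
Proof.
move=> [sphi [K [cK KO phi0]]]; split; first exact: smooth_partial.
exists K; split => //; elim: s => [//|i s IH].
apply: (derive_eq0_off (closed_compact_rV cK) _ IH) => x.
by apply: smooth_is_derive; exact: smooth_partial.
Qed.

Lemma test_L2 phi : test phi -> L2 phi.
Proof.
move=> [/smooth_continuous cphi [K [cK KO phi0]]].
apply: L2_of_integrable => //; first exact: continuous_measurable_rV.
apply: (integrable_continuous_compact mO cK).
  by move=> x; apply: continuousM; exact: cphi.
by move=> x /phi0 ->; rewrite mulr0.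
Qed.

(** The finite measure of [Omega] puts the constant 1 in L^2. *)
Lemma L2_integrable u : L2 u -> mu.-integrable Omega (EFin \o u).
Proof.
move=> Lu; have L1 : L2 (cst 1).
  split; first exact: measurable_cst.
  under eq_integral do rewrite expr1n.
  by rewrite integral_cst// mul1e.
apply: (eq_integrable mO _ _ _ (L2_integrableM mO Lu L1)) => x _ /=.
by rewrite mulr1.
Qed.

(** The derivative of psi phi has integral 0 over the whole space, and it vanishes off a compact
    subset of [Omega], so the integral over [Omega] is the same. *)
Lemma dot_partial1 i phi psi : test phi -> test psi ->
  dot psi (partial [:: i] phi) = - dot (partial [:: i] psi) phi.
Proof.
move=> tphi tpsi.
pose h x := psi x * phi x.
pose dh x := psi x * partial [:: i] phi x + phi x * partial [:: i] psi x.
have [sphi [K [cK KO phi0]]] := tphi; have [spsi _] := tpsi.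
have hdh x : is_derive x (delta_mx ord0 i) h (dh x).
  by apply: is_derive_dirM; exact: smooth_is_derive.
have cdh : continuous dh.
  move=> x; apply: (@continuousD _ _ _ (fun x => psi x * partial [:: i] phi x)
    (fun x => phi x * partial [:: i] psi x)); apply: continuousM; apply: smooth_continuous => //;
    exact: smooth_partial.
have h0 x : ~ K x -> h x = 0 by move=> /phi0; rewrite /h => ->; rewrite mulr0.
have dh0 := derive_eq0_off (closed_compact_rV cK) hdh h0.
have [M KM] := compact_sub_cbox cK.
have I0 : (\int[mu]_x (dh x)%:E = 0)%E.
  by apply: (integral_dir_derive_eq0 hdh cdh (l := fun=> - M) (u := fun=> M)) => x nx;
    apply: h0 => /KM.
have IO : \int[mu]_(x in Omega) dh x = 0.
  rewrite /Rintegral integral_mkcond (eq_integral (fun x => (dh x)%:E)) ?I0// => x _.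
  rewrite patchE; case: ifPn => //; rewrite notin_setE => nx.
  by rewrite dh0// => /KO.
have Lphi := test_L2 tphi; have Lpsi := test_L2 tpsi.
have Ldphi := test_L2 (test_partial [:: i] tphi).
have Ldpsi := test_L2 (test_partial [:: i] tpsi).
apply/eqP; rewrite -addr_eq0 [dot (partial _ _) _]dotC /dot -RintegralD//;
  try exact: L2_integrableM.
by rewrite [X in X == _]IO.
Qed.

(* Iterated integration by parts moves the outermost derivative first, hence
   [rev s]; no symmetry of the mixed derivatives is needed. *)
Lemma is_weak_partial_test s psi : test psi ->
  is_weak_partial Omega s psi (partial (rev s) psi).
Proof.
move=> tpsi phi tphi; rewrite -/(dot _ _) -/(dot _ _).
elim: s psi tpsi => [|i s IH] psi tpsi; first by rewrite expr0 mul1r.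
rewrite -[i :: s]cat1s partial_cat dot_partial1//; last exact: test_partial.
rewrite IH; last exact: test_partial.
by rewrite cat1s rev_cons -cats1 partial_cat/= exprS mulN1r mulNr.
Qed.

Lemma is_weak_partial_ae s u v w : L2 v -> L2 w ->
  is_weak_partial Omega s u v -> is_weak_partial Omega s u w ->
  null_on Omega (fun x => v x - w x).
Proof.
move=> Lv Lw uv uw; apply: null_on_test_functions => //.
  by apply: L2_integrable; exact: L2B.
move=> phi tphi; rewrite -[LHS]/(dot _ _) dotBl//; last exact: test_L2.
have := uv _ tphi; rewrite uw// => /(mulfI _) wv.
by rewrite /dot wv ?subrr// signr_eq0.
Qed.

Lemma is_weak_partialB s u v u' v' : L2 u -> L2 v -> L2 u' -> L2 v' ->
  is_weak_partial Omega s u v -> is_weak_partial Omega s u' v' ->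
  is_weak_partial Omega s (fun x => u x - u' x) (fun x => v x - v' x).
Proof.
move=> Lu Lv Lu' Lv' uv uv' phi tphi.
have Lphi := test_L2 tphi; have Lsphi := test_L2 (test_partial s tphi).
rewrite -[LHS]/(dot _ _) -[in RHS]/(dot _ _) !dotBl// mulrBr.
by congr (_ - _); [exact: uv|exact: uv'].
Qed.

Lemma weak_partialP s u : (exists v, L2 v /\ is_weak_partial Omega s u v) ->
  L2 (weak_partial Omega s u) /\ is_weak_partial Omega s u (weak_partial Omega s u).
Proof. by move=> uv; have := xgetPex (cst 0) uv. Qed.

Lemma weak_partial_ae s u v : L2 v -> is_weak_partial Omega s u v ->
  L2 (weak_partial Omega s u) /\
  null_on Omega (fun x => v x - weak_partial Omega s u x).
Proof.
move=> Lv uv; have [Lw uw] := weak_partialP (ex_intro _ v (conj Lv uv)).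
by split => //; exact: is_weak_partial_ae uv uw.
Qed.

(* [F] witnesses that u is in H^m_0. The limits v are left unnamed: they are
   the weak derivatives of u by uniqueness. *)
Definition H0seq (m : nat) F u := [/\ forall n, test (F n), L2 u, cvgL2 F u &
  forall s, (size s <= m)%N ->
    exists v, L2 v /\ cvgL2 (fun n => partial s (F n)) v].

(** For fixed phi, both sides of the integration by parts formula are continuous for L^2
    convergence. *)
Lemma is_weak_partial_lim s F u v : (forall n, test (F n)) -> L2 u -> L2 v ->
  cvgL2 F u -> cvgL2 (fun n => partial (rev s) (F n)) v ->
  is_weak_partial Omega s u v.
Proof.
move=> tF Lu Lv Fu Fv phi tphi.
have LF n : L2 (F n) by exact: test_L2.
have LsF n : L2 (partial (rev s) (F n)) by apply: test_L2; exact: test_partial.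
have c1 := cvgL2_dot mO LF Lu (test_L2 (test_partial s tphi)) Fu.
have c2 := @cvgM _ _ _ _ _ _ _ _ (cvg_cst ((-1) ^+ size s : R)) (cvgL2_dot mO LsF Lv (test_L2 tphi) Fv).
have E : (fun n => dot (F n) (partial s phi)) =
    cst ((-1) ^+ size s) \* (fun n => dot (partial (rev s) (F n)) phi).
  by apply/funext => n; rewrite /dot is_weak_partial_test.
by rewrite E in c1; exact: (cvg_unique (@norm_hausdorff _ R) c1 (c2 _ _)).
Qed.

Lemma H0seq_weak_partial m F u s : H0seq m F u -> (size s <= m)%N ->
  [/\ L2 (weak_partial Omega s u),
      is_weak_partial Omega s u (weak_partial Omega s u) &
      cvgL2 (fun n => partial (rev s) (F n)) (weak_partial Omega s u)].
Proof.
move=> [tF Lu Fu Fs] sm.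
have [v [Lv Fv]] : exists v, L2 v /\ cvgL2 (fun n => partial (rev s) (F n)) v.
  by apply: Fs; rewrite size_rev.
have uv := is_weak_partial_lim tF Lu Lv Fu Fv.
have [Lw vw] := weak_partial_ae Lv uv.
have [_ uw] := weak_partialP (ex_intro _ v (conj Lv uv)).
split => //; apply: cvgL2_ae Fv => // n.
by apply: test_L2; exact: test_partial.
Qed.

End weak.

(** * Approximation by test functions *)

Section energy.
Context {R : realType} {d : nat}.
Local Notation mu := (@lebesgue_rV R d).
Implicit Types (u v w f g phi psi : 'rV[R]_d -> R) (F G : nat -> 'rV[R]_d -> R)
  (s : seq 'I_d).
Variable Omega : set 'rV[R]_d.
Hypothesis oO : open Omega.
Hypothesis fO : (mu Omega < +oo)%E.
Local Notation L2 := (L2 Omega).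
Local Notation dot := (dot Omega).
Local Notation cvgL2 := (cvgL2 Omega).
Local Notation test := (test_function Omega).
Local Notation H0seq := (H0seq Omega).

Let mO : measurable Omega. Proof. exact: open_measurable_rV. Qed.

Let test_L2 phi : test phi -> L2 phi. Proof. exact: test_L2. Qed.

Lemma dot_fine f : \int[mu]_(x in Omega) f x ^+ 2 = dot f f.
Proof. by apply: eq_Rintegral => x _; rewrite expr2. Qed.

Lemma sobolev0_H0seq m u : sobolev0 Omega m u -> exists F, H0seq m F u.
Proof.
move=> [[Lu Su] appr].
have /choice[F HF] n : exists phi, test phi /\
    (sobolev_sqnorm Omega m (u \- phi)%R < (n.+1%:R^-1)%:E)%E.
  by apply: appr; rewrite invr_gt0.
have tF n : test (F n) by have [] := HF n.
(* The reversal matches the order in which iterated integration by parts moves the derivatives of a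
   test function. *)
have key s : (size s <= m)%N ->
    cvgL2 (fun n => partial s (F n)) (weak_partial Omega (rev s) u).
  move=> sm.
  have [Lw uw] := weak_partialP (Su (rev s) (leq_trans (eq_leq (size_rev s)) sm)).
  apply/cvgr0Pnorm_lt => e e0; near=> n; rewrite ger0_norm ?dot_ge0//.
  have Lp : L2 (partial s (F n)) by apply: test_L2; exact: test_partial.
  have wp : is_weak_partial Omega (rev s) (F n) (partial s (F n)).
    by have := is_weak_partial_test oO (rev s) (tF n); rewrite revK.
  (* The difference of the two derivatives is one weak derivative of u - F n; by uniqueness it
     agrees almost everywhere with the one chosen in [sobolev_sqnorm]. *)
  have wB := is_weak_partialB oO Lu Lw (test_L2 (tF n)) Lp uw wp.
  have LB := L2B mO Lw Lp.
  have [LW ae] := weak_partial_ae oO fO LB wB.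
  have [_ lt_n] := HF n.
  have W_lt : (\int[mu]_(x in Omega)
      (weak_partial Omega (rev s) (u \- F n) x ^+ 2)%:E < (n.+1%:R^-1)%:E)%E.
    apply: le_lt_trans lt_n; rewrite /sobolev_sqnorm.
    have sm' : (size (rev s) < m.+1)%N by rewrite ltnS size_rev.
    (* The integral to be bounded is one summand of [sobolev_sqnorm], whose other terms are
       nonnegative. *)
    pose t : (Ordinal sm').-tuple 'I_d := in_tuple (rev s).
    rewrite (bigD1 (Ordinal sm'))//= (bigD1 t)//= -addeA leeDl// adde_ge0//.
      by apply: sume_ge0 => i _; apply: integral_ge0 => x _; rewrite lee_fin sqr_ge0.
    apply: sume_ge0 => j _; apply: sume_ge0 => i _.
    by apply: integral_ge0 => x _; rewrite lee_fin sqr_ge0.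
  have -> : dot (fun x => partial s (F n) x - weak_partial Omega (rev s) u x)
      (fun x => partial s (F n) x - weak_partial Omega (rev s) u x) =
    dot (weak_partial Omega (rev s) (u \- F n)) (weak_partial Omega (rev s) (u \- F n)).
    rewrite -(dot_ae mO LB LW LW ae) dotC -(dot_ae mO LB LW LB ae).
    by apply: eq_Rintegral => x _; ring.
  rewrite -dot_fine -lte_fin fineK; last first.
    rewrite ge0_fin_numE; first exact: lt_trans W_lt (ltry _).
    by apply: integral_ge0 => x _; rewrite lee_fin sqr_ge0.
  apply: lt_trans W_lt _; rewrite lte_fin.
  near: n; have /cvgr0_norm_lt := @cvg_harmonic R.
  move=> /(_ _ e0); apply: filterS => n; rewrite ger0_norm//.
  by rewrite invr_ge0.
exists F; split => //.
(* Even for the empty multi-index, the chosen weak derivative is only almost everywhere equal to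
   u. *)
- have wu : is_weak_partial Omega [::] u u by move=> phi _; rewrite expr0 mul1r.
  have [Lw uw] := weak_partial_ae oO fO Lu wu.
  apply: (cvgL2_ae mO _ Lw Lu _ (key [::] (leq0n _))).
    by move=> n; exact: (test_L2 (tF n)).
  apply: filterS uw => x /[swap] Ox /(_ Ox)/eqP.
  by rewrite -oppr_eq0 opprB => /eqP.
- move=> s sm; exists (weak_partial Omega (rev s) u); split; last exact: key.
  by have [] := weak_partialP (Su (rev s) (leq_trans (eq_leq (size_rev s)) sm)).
Unshelve. all: by end_near. Qed.

(** The min-max formula hands over a basis in H^m_0, whereas the energies are compared on its linear
    combinations. *)
Lemma H0seq_lincomb m k (b : 'I_k -> 'rV[R]_d -> R) c
    (F : 'I_k -> nat -> 'rV[R]_d -> R) :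
  (forall i, H0seq m (F i) (b i)) ->
  H0seq m (fun n x => \sum_(i < k) c i * F i n x) (lincomb b c).
Proof.
move=> HF.
have tF i n : test (F i n) by have [] := HF i.
have Lb i : L2 (b i) by have [] := HF i.
split.
- by move=> n; apply: test_sum => i; exact: testZ.
- by apply: L2_sum => // i; exact: L2Z.
- apply: cvgL2_sum => // [i n|i|i].
  + by apply: L2Z => //; exact: test_L2.
  + exact: L2Z.
  + by apply: cvgL2Z => //; [move=> n; exact: test_L2|have [] := HF i].
- move=> s sm.
  have /choice[v Hv] i : exists v, L2 v /\ cvgL2 (fun n => partial s (F i n)) v.
    by have [_ _ _ /(_ s sm)] := HF i.
  exists (fun x => \sum_(i < k) c i * v i x); split.
    by apply: L2_sum => // i; apply: L2Z => //; exact: (Hv i).1.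
  rewrite (_ : (fun n => _) = fun n x => \sum_(i < k) c i * partial s (F i n) x).
    apply: cvgL2_sum => // [i n|i|i].
    + by apply: L2Z => //; apply: test_L2; exact: test_partial.
    + by apply: L2Z => //; exact: (Hv i).1.
    + apply: cvgL2Z => //; [|exact: (Hv i).1|exact: (Hv i).2].
      by move=> n; apply: test_L2; exact: test_partial.
  apply/funext => n; rewrite partial_sum; last first.
    by move=> i; apply: smoothZ; exact: (tF i n).1.
  by apply/funext => x; apply: eq_bigr => i _; rewrite partialZ//; exact: (tF i n).1.
Qed.

Definition lap phi : 'rV[R]_d -> R := fun x => \sum_(i < d) partial [:: i; i] phi x.

Lemma test_lap phi : test phi -> test (lap phi).
Proof. by move=> tphi; apply: test_sum => i; exact: (test_partial [:: i; i] tphi). Qed.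

Lemma test_iter_lap j phi : test phi -> test (iter j lap phi).
Proof. by elim: j => //= j IH /IH; exact: test_lap. Qed.

(** Costs two orders, since the derivative s of the Laplacian is a sum of derivatives [s ++
    [:: i; i]]. As the conclusion has the form of the hypothesis, it can be iterated. *)
Lemma H0seq_laplacian m F u : H0seq m.+2 F u ->
  H0seq m (fun n => lap (F n)) (laplacian Omega u).
Proof.
move=> H; have [tF Lu Fu Fs] := H.
have Hw i := H0seq_weak_partial oO fO H (s := [:: i; i]) isT.
split.
- by move=> n; exact: test_lap.
- by apply: L2_sum => // i; have [] := Hw i.
- apply: cvgL2_sum => // [i n|i|i].
  + exact: (test_L2 (test_partial [:: i; i] (tF n))).
  + by have [] := Hw i.
  + by have [] := Hw i.
- move=> s sm.
  have /choice[v Hv] i : exists v, L2 v /\ cvgL2 (fun n => partial (s ++ [:: i; i]) (F n)) v.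
    by apply: Fs; rewrite size_cat/= addn2 !ltnS.
  exists (fun x => \sum_(i < d) v i x); split.
    by apply: L2_sum => // i; exact: (Hv i).1.
  rewrite (_ : (fun n => _) = fun n x => \sum_(i < d) partial (s ++ [:: i; i]) (F n) x).
    apply: cvgL2_sum => // [i n|i|i].
    + exact: (test_L2 (test_partial (s ++ [:: i; i]) (tF n))).
    + exact: (Hv i).1.
    + exact: (Hv i).2.
  apply/funext => n; rewrite /lap partial_sum; last first.
    by move=> i; exact: (test_partial [:: i; i] (tF n)).1.
  by apply/funext => x; apply: eq_bigr => i _; rewrite partial_cat.
Qed.

Lemma H0seq_iter_laplacian m j F u : (j.*2 <= m)%N -> H0seq m F u ->
  H0seq (m - j.*2) (fun n => iter j lap (F n)) (iter j (laplacian Omega) u).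
Proof.
elim: j m => [|j IH] m jm H; first by rewrite subn0.
rewrite !iterS; apply: H0seq_laplacian.
rewrite (_ : (m - j.+1.*2).+2 = (m - j.*2)%N); last by move: jm; lia.
by apply: IH => //; move: jm; lia.
Qed.

End energy.

(** * Log-convexity of the energies *)

Section logconvex.
Context {R : realType} {d : nat}.
Local Notation mu := (@lebesgue_rV R d).
Implicit Types (u v w f g phi psi : 'rV[R]_d -> R) (F G : nat -> 'rV[R]_d -> R)
  (s : seq 'I_d).
Variable Omega : set 'rV[R]_d.
Hypothesis oO : open Omega.
Hypothesis fO : (mu Omega < +oo)%E.
Local Notation L2 := (L2 Omega).
Local Notation dot := (dot Omega).
Local Notation cvgL2 := (cvgL2 Omega).
Local Notation test := (test_function Omega).
Local Notation H0seq := (H0seq Omega).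

Let mO : measurable Omega. Proof. exact: open_measurable_rV. Qed.

Let test_L2 phi : test phi -> L2 phi. Proof. exact: test_L2. Qed.

Definition energy p u : R := \int[mu]_(x in Omega) sqr_nabla Omega p u x.

Definition test_energy p phi : R :=
  let v := iter p./2 lap phi in
  if odd p then \sum_(i < d) dot (partial [:: i] v) (partial [:: i] v) else dot v v.

Lemma dot0l g : dot (cst 0) g = 0.
Proof.
rewrite /dot (@eq_Rintegral _ _ _ _ _ (cst 0)); first by rewrite /Rintegral integral0.
by move=> x _; rewrite mul0r.
Qed.

Lemma dot_suml (I : Type) (r : seq I) (f : I -> 'rV[R]_d -> R) g :
  (forall i, L2 (f i)) -> L2 g ->
  dot (fun x => \sum_(i <- r) f i x) g = \sum_(i <- r) dot (f i) g.
Proof.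
move=> Lf Lg; elim: r => [|i r IH].
  rewrite big_nil -[RHS](dot0l g).
  by apply: eq_Rintegral => x _; rewrite big_nil.
rewrite big_cons -IH -dotDl//; last exact: L2_sum.
by apply: eq_Rintegral => x _; rewrite big_cons.
Qed.

Lemma Rintegral_sum_sqr (I : Type) (r : seq I) (f : I -> 'rV[R]_d -> R) :
  (forall i, L2 (f i)) ->
  \int[mu]_(x in Omega) (\sum_(i <- r) f i x ^+ 2) = \sum_(i <- r) dot (f i) (f i).
Proof.
move=> Lf; have If i : mu.-integrable Omega (EFin \o (fun x => f i x ^+ 2)).
  by apply: (eq_integrable mO _ _ _ (L2_integrableM mO (Lf i) (Lf i))) => x _ /=;
    rewrite expr2.
have Is r' : mu.-integrable Omega (EFin \o (fun x => \sum_(i <- r') f i x ^+ 2)).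
  apply: (eq_integrable mO _ _ _ (integrable_sum mO r' (P := xpredT) (fun i _ => If i)))
    => x _ /=.
  by rewrite sumEFin.
elim: r => [|i r IH].
  rewrite big_nil (@eq_Rintegral _ _ _ _ _ (cst 0)); first by rewrite /Rintegral integral0.
  by move=> x _; rewrite big_nil.
rewrite big_cons -IH -dot_fine -RintegralD//.
by apply: eq_Rintegral => x _; rewrite big_cons.
Qed.

Lemma energyE m F u p : H0seq m F u -> (p <= m)%N ->
  let v := iter p./2 (laplacian Omega) u in
  energy p u = if odd p
    then \sum_(i < d) dot (weak_partial Omega [:: i] v) (weak_partial Omega [:: i] v)
    else dot v v.
Proof.
move=> H pm v; rewrite /energy /sqr_nabla -/v; case: ifPn => op.
  have pm' : (p./2.*2 <= m)%N by lia.
  have Hv := H0seq_iter_laplacian oO fO pm' H.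
  rewrite Rintegral_sum_sqr// => i.
  have sz : (size [:: i] <= m - p./2.*2)%N by move: pm op => /=; lia.
  by have [] := H0seq_weak_partial oO fO Hv sz.
exact: dot_fine.
Qed.

Lemma cvg_test_energy m F u p : H0seq m F u -> (p <= m)%N ->
  (fun n => test_energy p (F n)) @ \oo --> energy p u.
Proof.
move=> H pm; rewrite (energyE H pm) /test_energy.
have pm' : (p./2.*2 <= m)%N by lia.
have Hv := H0seq_iter_laplacian oO fO pm' H; have [tv Lv Fv _] := Hv.
case: ifPn => op; last by apply: cvgL2_sqr => // n; exact: test_L2.
apply: cvg_big => [x|i _]; first exact: add_continuous.
have sz : (size [:: i] <= m - p./2.*2)%N by move: pm op => /=; lia.
have [Lw _ Fw] := H0seq_weak_partial oO fO Hv sz.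
by apply: cvgL2_sqr => // n; exact: (test_L2 (test_partial [:: i] (tv n))).
Qed.

Lemma energy_ge0 p u : 0 <= energy p u.
Proof.
apply: Rintegral_ge0 => x _; rewrite /sqr_nabla; case: ifP => _; last exact: sqr_ge0.
by apply: sumr_ge0 => i _; exact: sqr_ge0.
Qed.

Lemma test_energy_logconvex p phi : test phi ->
  test_energy p.+1 phi ^+ 2 <= test_energy p phi * test_energy p.+2 phi.
Proof.
move=> tphi; rewrite /test_energy.
have tv : test (iter p./2 lap phi) by exact: test_iter_lap.
have [op|ep] := boolP (odd p).
  rewrite /= op/= uphalf_half op/= ?add1n/=.
  set v := iter _ _ _ in tv *.
  pose w := lap v; have tw : test w by exact: test_lap.
  have Lw := test_L2 tw.
  have Ldv i := test_L2 (test_partial [:: i] tv).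
  have Ldw i := test_L2 (test_partial [:: i] tw).
  have Lddv i := test_L2 (test_partial [:: i; i] tv).
  (* For p odd and w = Delta v, the integral of w^2 is minus that of grad v . grad w: the outer
     derivative of each second derivative of v moves to w. *)
  have -> : dot (lap v) (lap v) =
     - \sum_(i < d) dot (partial [:: i] v) (partial [:: i] w).
    rewrite {1}/lap dot_suml// -sumrN; apply: eq_bigr => i _.
    rewrite dotC; apply: etrans (dot_partial1 oO i (test_partial [:: i] tv) tw) _.
    by rewrite dotC.
  by rewrite sqrrN; exact: sum_dot_CauchySchwarz.
rewrite /= (negbTE ep)/= uphalf_half (negbTE ep)/= ?add0n.
set v := iter _ _ _ in tv *.
have Lv := test_L2 tv.
have Lw := test_L2 (test_lap tv).
have Lddv i := test_L2 (test_partial [:: i; i] tv).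
(* For p even, the integral of |grad v|^2 is minus that of v Delta v. *)
have -> : \sum_(i < d) dot (partial [:: i] v) (partial [:: i] v) = - dot v (lap v).
  rewrite dotC /lap dot_suml// -sumrN; apply: eq_bigr => i _.
  apply/esym; rewrite dotC.
  apply: etrans (congr1 -%R (dot_partial1 oO i (test_partial [:: i] tv) tv)) _.
  by rewrite opprK.
by rewrite sqrrN; exact: dot_CauchySchwarz.
Qed.

Lemma energy_logconvex m F u p : H0seq m F u -> (p.+2 <= m)%N ->
  energy p.+1 u ^+ 2 <= energy p u * energy p.+2 u.
Proof.
move=> H pm; have [tF _ _ _] := H.
have c1 := cvg_test_energy H (ltnW pm).
have c0 := cvg_test_energy H (ltnW (ltnW pm)).
have c2 := cvg_test_energy H pm.
rewrite expr2.
apply: (ler_cvg_to (cvgM c1 c1) (cvgM c0 c2)); apply: nearW => n /=.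
by rewrite -expr2; exact: test_energy_logconvex.
Qed.

Lemma dot_eq0_l f g : L2 f -> L2 g -> dot f f = 0 -> dot f g = 0.
Proof.
move=> Lf Lg f0; have := dot_CauchySchwarz mO Lf Lg; rewrite f0 mul0r => h.
by apply/eqP; rewrite -sqrf_eq0 eq_le h sqr_ge0.
Qed.

Lemma weak_partial_eq0 s v : L2 v -> is_weak_partial Omega s v (cst 0) ->
  dot (weak_partial Omega s v) (weak_partial Omega s v) = 0.
Proof.
move=> Lv v0; have L0 := @L2_0 R d Omega.
have [Lw w0] := weak_partial_ae oO fO L0 v0.
by rewrite -(dot_ae mO L0 Lw Lw w0) dot0l.
Qed.

(* Log-convexity yields this only for p + 2 <= m. The last step is needed since
   a Rayleigh quotient with denominator 0 has value 0. *)
Lemma energy_eq0 m F u p : H0seq m F u -> (p < m)%N ->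
  energy p u = 0 -> energy p.+1 u = 0.
Proof.
move=> H pm; rewrite (energyE H (ltnW pm)) (energyE H pm).
have pm' : (p./2.*2 <= m)%N by lia.
have Hv := H0seq_iter_laplacian oO fO pm' H; have [tv Lv Fv _] := Hv.
have [op|ep] := boolP (odd p).
  rewrite /= op/= uphalf_half op/= ?add1n/=.
  set v := iter _ _ _ in Hv tv Lv Fv *.
  move=> /eqP; rewrite psumr_eq0; last by move=> i _; exact: dot_ge0.
  move=> /allP w0.
  have {}w0 i : dot (weak_partial Omega [:: i] v) (weak_partial Omega [:: i] v) = 0.
    by apply/eqP; apply: w0; rewrite mem_index_enum.
  have Hi i : L2 (weak_partial Omega [:: i; i] v).
    have sz : (size [:: i; i] <= m - p./2.*2)%N by move: pm op => /=; lia.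
    by have [] := H0seq_weak_partial oO fO Hv sz.
  have W0 i : dot (weak_partial Omega [:: i; i] v) (weak_partial Omega [:: i; i] v) = 0.
    apply: weak_partial_eq0 => // phi tphi.
    have sz : (size [:: i] <= m - p./2.*2)%N by move: pm op => /=; lia.
    have [Lw wv _] := H0seq_weak_partial oO fO Hv sz.
    rewrite -[LHS]/(dot _ _) -[in RHS]/(dot _ _) dot0l mulr0.
    (* Use the first-order weak derivative of v with the test function d_i phi: the integral of v
       d_i d_i phi is minus that of a null function times d_i phi. *)
    have := wv _ (test_partial [:: i] tphi).
    rewrite -[X in X = _ -> _]/(dot _ _) -[X in _ = _ * X -> _]/(dot _ _).
    rewrite [X in _ = _ * X -> _]dot_eq0_l// ?mulr0//.
    exact: (test_L2 (test_partial [:: i] tphi)).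
  have Ls : L2 (laplacian Omega v) by exact: L2_sum.
  rewrite {1}/laplacian dot_suml//; apply: big1 => i _.
  exact: dot_eq0_l.
rewrite /= (negbTE ep)/= uphalf_half (negbTE ep)/= ?add0n.
set v := iter _ _ _ in Hv tv Lv Fv *.
move=> v0; apply: big1 => i _; apply: weak_partial_eq0 => // phi tphi.
rewrite -[LHS]/(dot _ _) -[in RHS]/(dot _ _) dot0l mulr0 dot_eq0_l//.
exact: (test_L2 (test_partial [:: i] tphi)).
Qed.

End logconvex.

(** * Comparison of the eigenvalues *)

Section logconvex_sequence.
Context {R : realType}.
Variables (a : nat -> R) (m : nat).
Hypothesis a_ge0 : forall p, 0 <= a p.
Hypothesis a_logconvex : forall p, (p.+2 <= m)%N -> a p.+1 ^+ 2 <= a p * a p.+2.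
Hypothesis a_eq0 : forall p, (p < m)%N -> a p = 0 -> a p.+1 = 0.

(** Zeros propagate upwards by [a_eq0], so positivity propagates downwards and the ratios below q
    are genuine. *)
Lemma logconvex_gt0 p q : (p <= q)%N -> (q <= m)%N -> 0 < a q -> 0 < a p.
Proof.
move=> pq qm aq; rewrite lt0r a_ge0 andbT; apply/eqP => ap.
suff aq0 : a q = 0 by rewrite aq0 ltxx in aq.
elim: q pq qm {aq} => [|q IH]; first by rewrite leqn0 => /eqP <-.
by rewrite leq_eqVlt => /predU1P[<-//|pq] qm; apply: a_eq0 => //; apply: IH => //; exact: ltnW.
Qed.

Lemma logconvex_ratio p q : (p <= q)%N -> (q < m)%N -> 0 < a q ->
  a p.+1 / a p <= a q.+1 / a q.
Proof.
elim: q => [|q IH]; first by rewrite leqn0 => /eqP ->.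
rewrite leq_eqVlt => /predU1P[->//|pq] qm aq.
have aq' : 0 < a q by apply: logconvex_gt0 aq => //; exact: ltnW.
apply: (le_trans (IH pq (ltnW qm) aq')).
by rewrite ler_pdivrMr// mulrAC ler_pdivlMr// -expr2 mulrC a_logconvex.
Qed.

(** a(p+n) / a(p) is a product of n ratios with indices from p to p + n - 1; the last index may be q
    itself, hence [q.+1]. *)
Lemma logconvex_le_exp p n q : (p + n <= q.+1)%N -> (q < m)%N -> 0 < a q ->
  a (p + n) <= a p * (a q.+1 / a q) ^+ n.
Proof.
elim: n => [|n IH] pn qm aq; first by rewrite addn0 expr0 mulr1.
have pnq : (p + n <= q)%N by rewrite -ltnS -addnS.
have apn : 0 < a (p + n) by apply: logconvex_gt0 aq => //; exact: ltnW.
have := logconvex_ratio pnq qm aq; rewrite ler_pdivrMr// addnS => h.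
apply: (le_trans h); rewrite exprS mulrCA ler_wpM2l ?divr_ge0//.
by apply: IH => //; exact: leqW.
Qed.

Lemma logconvex_ge_exp p n : (p + n <= m)%N -> 0 < a (p + n) ->
  a p * (a p.+1 / a p) ^+ n <= a (p + n).
Proof.
elim: n => [|n IH] pn apn; first by rewrite addn0 expr0 mulr1.
rewrite addnS in pn apn *.
have apn' : 0 < a (p + n) by exact: logconvex_gt0 apn.
have := logconvex_ratio (leq_addr n p) pn apn'; rewrite ler_pdivlMr// => h.
apply: le_trans h; rewrite exprS mulrCA ler_wpM2l ?divr_ge0//.
by apply: IH => //; exact: ltnW.
Qed.

(** Let P be the product of the last t ratios and Q that of the s - t before them. The claim (P Q)^t
    <= P^s reduces to Q^t <= P^(s-t). The first ratio r in P separates the two: Q <= r^(s-t) and r^t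
    <= P. *)
Lemma logconvex_quotient_exp t s : (t <= s)%N -> (s <= m)%N -> (0 < t)%N ->
  (a m / a (m - s)) ^+ t <= (a m / a (m - t)) ^+ s.
Proof.
move=> ts sm t0.
have [am0|am0] := eqVneq (a m) 0.
  by rewrite am0 !mul0r !expr0n !eqn0Ngt t0 (leq_trans t0 ts).
have {}am0 : 0 < a m by rewrite lt0r am0 a_ge0.
have as0 : 0 < a (m - s) by apply: logconvex_gt0 am0 => //; lia.
have at0 : 0 < a (m - t) by apply: logconvex_gt0 am0 => //; lia.
pose r := a (m - t).+1 / a (m - t).
have r0 : 0 <= r by rewrite divr_ge0.
pose Q := a (m - t) / a (m - s); pose P := a m / a (m - t).
have EPQ : a m / a (m - s) = P * Q by rewrite /P /Q; field; rewrite !gt_eqF.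
have Q0 : 0 <= Q by rewrite divr_ge0.
have P0 : 0 <= P by rewrite divr_ge0.
have QP : Q <= r ^+ (s - t).
  rewrite ler_pdivrMr// mulrC.
  have := @logconvex_le_exp (m - s) (s - t) (m - t).
  rewrite (_ : (m - s + (s - t) = m - t)%N); last lia.
  by apply => //; lia.
have Pr : r ^+ t <= P.
  rewrite ler_pdivlMr// mulrC.
  have := @logconvex_ge_exp (m - t) t.
  by rewrite (_ : (m - t + t = m)%N); last lia; apply.
rewrite EPQ exprMn -(subnKC ts) exprD ler_wpM2l ?exprn_ge0//.
apply: (@le_trans _ _ ((r ^+ (s - t)) ^+ t)); first by rewrite lerXn2r// nnegrE exprn_ge0.
by rewrite -exprM mulnC exprM lerXn2r// nnegrE exprn_ge0.
Qed.

(** After cross-multiplication this compares the ratios at n - t and at n: the factors in between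
    are common. *)
Lemma logconvex_quotient_succ n t : m = n.+1 -> (0 < t)%N -> (t <= n)%N ->
  a n / a (n - t) <= a n.+1 / a (n - t).+1.
Proof.
move=> mn t0 tn.
have [an0|an0] := eqVneq (a n) 0; first by rewrite an0 mul0r divr_ge0.
have {}an0 : 0 < a n by rewrite lt0r an0 a_ge0.
have h p : (p <= n)%N -> 0 < a p.
  by move=> pn; apply: logconvex_gt0 an0 => //; rewrite mn.
have h1 := h (n - t)%N (leq_subr _ _).
have h2 : 0 < a (n - t).+1 by apply: h; lia.
have := @logconvex_ratio (n - t) n (leq_subr _ _).
rewrite mn => /(_ (leqnn _) an0).
by rewrite !ler_pdivrMr// mulrAC ler_pdivlMr// mulrAC ler_pdivlMr// [a n * _]mulrC.
Qed.

(** With X = a(n) / a(n-t) and r = a(n+1) / a(n), the claim X^(t+1) <= (X r)^t reduces to X <= r^t,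
    where X is a product of t ratios, none above r. *)
Lemma logconvex_quotient_exp_succ n t : m = n.+1 -> (0 < t)%N -> (t <= n)%N ->
  (a n / a (n - t)) ^+ t.+1 <= (a n.+1 / a (n - t)) ^+ t.
Proof.
move=> mn t0 tn.
have [an0|an0] := eqVneq (a n) 0.
  by rewrite an0 mul0r expr0n/= exprn_ge0// divr_ge0.
have {}an0 : 0 < a n by rewrite lt0r an0 a_ge0.
have ant : 0 < a (n - t).
  by apply: logconvex_gt0 an0; [exact: leq_subr|rewrite mn].
have -> : a n.+1 / a (n - t) = (a n / a (n - t)) * (a n.+1 / a n).
  by field; rewrite !gt_eqF.
rewrite exprSr [leRHS]exprMn ler_wpM2l ?exprn_ge0 ?divr_ge0// ler_pdivrMr// mulrC.
have := @logconvex_le_exp (n - t) t n.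
by rewrite subnK//; apply => //; rewrite mn.
Qed.

End logconvex_sequence.

(** * Transfer to the eigenvalues by the min-max formula *)

Section minmax.
Context {R : realType} {d : nat}.
Variable Omega : set 'rV[R]_d.
Hypothesis oO : open Omega.
Hypothesis fO : (lebesgue_rV d Omega < +oo)%E.

Lemma sobolev0S m u : sobolev0 Omega m.+1 u -> sobolev0 Omega m u.
Proof.
move=> [[Lu Su] appr]; split; first by split => // s sm; apply: Su; exact: leqW.
move=> e /appr[phi [tphi lt_e]]; exists phi; split => //.
apply: le_lt_trans lt_e; rewrite /sobolev_sqnorm [leRHS]big_ord_recr/= leeDl//.
by apply: sume_ge0 => i _; apply: integral_ge0 => x _; rewrite lee_fin sqr_ge0.
Qed.

Lemma rayleigh_ge0 m t u : 0 <= rayleigh Omega m t u.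
Proof. by rewrite /rayleigh divr_ge0//; exact: energy_ge0. Qed.

(** For k > 0 a basis vector is a nonnull combination, so the inner supremum runs over a nonempty
    set and is not -oo. *)
Lemma kth_eigenvalue_ge0 m t k : (0 < k)%N -> (0 <= kth_eigenvalue Omega m t k)%E.
Proof.
move=> k0; apply: le_ereal_inf_tmp => _ [b [_ bfree] <-].
pose i0 := Ordinal k0.
pose u := lincomb b (fun i => (i == i0)%:R).
apply: (@le_trans _ _ (rayleigh Omega m t u)%:E); first by rewrite lee_fin rayleigh_ge0.
apply: ereal_sup_ubound; exists u => //; split; first by eexists.
by move=> /bfree/(_ i0)/eqP; rewrite eqxx oner_eq0.
Qed.

(** Every basis admissible on the right is admissible on the left. The exponents cross because R^a
    <= R'^b means R^(1/b) <= R'^(1/a). *)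
Lemma kth_eigenvalue_le m t m' t' k a b : (0 < a)%N -> (0 < b)%N -> (0 < k)%N ->
  (forall u, sobolev0 Omega m' u -> sobolev0 Omega m u) ->
  (forall F u, H0seq Omega m' F u ->
    rayleigh Omega m t u ^+ a <= rayleigh Omega m' t' u ^+ b) ->
  (poweR (kth_eigenvalue Omega m t k) b%:R^-1 <=
   poweR (kth_eigenvalue Omega m' t' k) a%:R^-1)%E.
Proof.
move=> a0 b0 k0 sub ray.
have aR0 : 0 < a%:R :> R by rewrite ltr0n.
have bR0 : 0 < b%:R :> R by rewrite ltr0n.
set l := kth_eigenvalue _ m t k; set l' := kth_eigenvalue _ m' t' k.
have l0 : (0 <= l)%E by exact: kth_eigenvalue_ge0.
have l0' : (0 <= l')%E by exact: kth_eigenvalue_ge0.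
have mono (x y : \bar R) r : 0 <= r -> (0 <= x)%E -> (x <= y)%E ->
    (poweR x r <= poweR y r)%E.
  move=> r0 x0 xy; apply: gt0_ler_poweR => //; rewrite in_itv/= leey andbT//.
  exact: le_trans xy.
(* With no power left on the right, it suffices to bound the supremum [S] of each single basis from
   below. *)
suff : (poweR l (a%:R / b%:R) <= l')%E.
  move=> /(mono _ _ a%:R^-1); rewrite -poweRrM.
  rewrite (_ : a%:R / b%:R / a%:R = b%:R^-1); last by field; rewrite !gt_eqF.
  by apply; [rewrite invr_ge0 ltW|exact: poweR_ge0].
apply: le_ereal_inf_tmp => _ [bs [bs0 bfree] <-].
set S := ereal_sup _.
have S0 : (0 <= S)%E.
  pose i0 := Ordinal k0.
  pose u := lincomb bs (fun i => (i == i0)%:R).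
  apply: (@le_trans _ _ (rayleigh Omega m' t' u)%:E); first by rewrite lee_fin rayleigh_ge0.
  apply: ereal_sup_ubound; exists u => //; split; first by eexists.
  by move=> /bfree/(_ i0)/eqP; rewrite eqxx oner_eq0.
have lS : (l <= poweR S (b%:R / a%:R))%E.
  apply: (@le_trans _ _ (ereal_sup [set (rayleigh Omega m t u)%:E |
      u in [set u | (exists c, u = lincomb bs c) /\ ~ null_on Omega u]])).
    apply: ereal_inf_lbound; exists bs => //; split => // i; exact: sub.
  apply: ge_ereal_sup => _ [u [[c uE] nu] <-].
  have RS : ((rayleigh Omega m' t' u)%:E <= S)%E.
    by apply: ereal_sup_ubound; exists u => //; split => //; exists c.
  have /choice[F HF] i : exists F, H0seq Omega m' F (bs i).
    exact: sobolev0_H0seq.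
  have Hu : H0seq Omega m' (fun n x => \sum_(i < k) c i * F i n x) u.
    by rewrite uE; exact: H0seq_lincomb.
  apply: le_trans (mono _ _ (b%:R / a%:R) _ _ RS); last 2 first.
    by rewrite divr_ge0// ltW.
    by rewrite lee_fin rayleigh_ge0.
  rewrite poweR_EFin lee_fin powRrM powR_mulrn ?rayleigh_ge0//.
  have -> : rayleigh Omega m t u = (rayleigh Omega m t u ^+ a) `^ a%:R^-1.
    by rewrite -powR_mulrn ?rayleigh_ge0// -powRrM mulfV ?gt_eqF// powRr1 ?rayleigh_ge0.
  apply: ge0_ler_powR; rewrite ?nnegrE ?exprn_ge0 ?rayleigh_ge0 ?invr_ge0 ?(ltW aR0)//.
  exact: ray Hu.
have := mono _ _ (a%:R / b%:R) _ l0 lS; rewrite -poweRrM.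
rewrite (_ : b%:R / a%:R * (a%:R / b%:R) = 1); last by field; rewrite !gt_eqF.
by rewrite poweRe1//; apply; rewrite divr_ge0// ltW.
Qed.

End minmax.

Theorem theorem5 (R : realType) (d : nat) (Omega : set 'rV[R]_d)
  (hd : (0 < d)%N) (hOmega : domain Omega)
  (hfin : (lebesgue_rV d Omega < +oo)%E)
  (k t s m : nat) (hk : (0 < k)%N) (ht : (0 < t)%N)
  (hts : (t <= s)%N) (hsm : (s <= m)%N) :
  [/\ (poweR (kth_eigenvalue Omega m t k) (t%:R^-1) <=
        poweR (kth_eigenvalue Omega m.+1 t.+1 k) (t.+1%:R^-1))%E,
      (kth_eigenvalue Omega m t k <= kth_eigenvalue Omega m.+1 t k)%E &
      (poweR (kth_eigenvalue Omega m s k) (s%:R^-1) <=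
        poweR (kth_eigenvalue Omega m t k) (t%:R^-1))%E].
Proof.
have [oO _] := hOmega; have tm := leq_trans hts hsm.
split.
- apply: kth_eigenvalue_le => //; first exact: sobolev0S.
  move=> F u H; rewrite /rayleigh subSS -!/(energy _ _ _).
  apply: (@logconvex_quotient_exp_succ _ (fun p => energy Omega p u) m.+1) => //.
  + by move=> p; exact: energy_ge0.
  + by move=> p; exact: energy_logconvex H.
  + by move=> p; exact: energy_eq0 H.
- have := @kth_eigenvalue_le _ _ Omega oO hfin m t m.+1 t k 1 1 isT isT hk.
  rewrite invr1 !poweRe1 ?kth_eigenvalue_ge0//; apply; first exact: sobolev0S.
  move=> F u H; rewrite !expr1 /rayleigh subSn// -!/(energy _ _ _).
  apply: (@logconvex_quotient_succ _ (fun p => energy Omega p u) m.+1) => //.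
  + by move=> p; exact: energy_ge0.
  + by move=> p; exact: energy_logconvex H.
  + by move=> p; exact: energy_eq0 H.
(* Here a = t and b = s: the quotient for (m,s) to the power t is compared with that for (m,t) to
   the power s. *)
- apply: kth_eigenvalue_le => //; first exact: leq_trans ht hts.
  move=> F u H; rewrite /rayleigh -!/(energy _ _ _).
  apply: (@logconvex_quotient_exp _ (fun p => energy Omega p u) m) => //.
  + by move=> p; exact: energy_ge0.
  + by move=> p; exact: energy_logconvex H.
  + by move=> p; exact: energy_eq0 H.
Qed.
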